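(* Let $N\ge 1$ be an integer and let $f:[0,+\infty)\to\mathbb{R}$ satisfy: (a) $f\in C^1([0,+\infty))$; (b) $f(0)=f(1)=0$, $f(s)<0$ for $0<s<1$, and $f(s)>0$ for $s>1$; (c) $f'(1)=0$. Then for every integer $k\ge 1$ there exists $R_k^*>0$ such that, for every $R\ge R_k^*$, the Neumann problem $$ \begin{cases} -\operatorname{div}\left(\dfrac{\nabla u}{\sqrt{1-|\nabla u|^2}}\right)=f(u) & \text{in } B_R,\\ u>0,\quad u \text{ radial} & \text{in } B_R,\\ \partial_\nu u=0 & \text{on } \partial B_R \end{cases} $$ admits $4k$ distinct non-constant solutions $u_1^{\pm},\ldots,u_{2k}^{\pm}$. Moreover, writing $u(x)=u(r)$ with $r=|x|$: (i) $u_j^{+}(0)>1$ for every $j=1,\ldots,2k$; (ii) $u_j^{-}(0)<1$ for every $j=1,\ldots,2k$; (iii) for every $j=1,\ldots,k$ and for each choice of sign $\pm$, the functions $u_j^{\pm}(r)-1$ and $u_{2k+1-j}^{\pm}(r)-1$ have exactly $j$ zeros for $r\in(0,R)$.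
   Context: $B_R\subset\mathbb{R}^N$ denotes the ball of radius $R$ centered at the origin and $\nu$ the outer unit normal of $\partial B_R$. A radial function is identified with its profile $u(r)$, $r=|x|\in[0,R]$. In terms of the profile, the problem is equivalent to the ODE problem $$\left(r^{N-1}\frac{u'}{\sqrt{1-(u')^2}}\right)'+r^{N-1}f(u)=0 \ \text{ in } (0,R),\qquad u>0,\qquad u'(0)=u'(R)=0,$$ and solutions are understood in the classical sense ($u\in C^2([0,R])$ with $|u'|<1$ on $[0,R]$). *)

(* Defs.v *)
From HB Require Import structures.
From mathcomp Require Export all_boot all_order all_algebra.
From mathcomp Require Export all_classical all_reals all_analysis.
Export Order.TTheory GRing.Theory Num.Theory numFieldNormedType.Exports.

Set Implicit Arguments.
Unset Strict Implicit.
Unset Printing Implicit Defensive.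

Local Open Scope classical_set_scope.
Local Open Scope ring_scope.

(* f' is the derivative of f along D.  The difference quotient is taken inside
   D only, hence the derivative is one-sided at the end points of an interval
   and the values of f outside D are irrelevant. *)
Definition has_deriv_on (R : realType) (D : set R) (f f' : R -> R) : Prop :=
  forall x, D x -> (fun y => (f y - f x) / (y - x)) @ within D x^' --> f' x.

Definition C1_on (R : realType) (D : set R) (f : R -> R) : Prop :=
  exists f' : R -> R, has_deriv_on D f f' /\ {within D, continuous f'}.

(* The norm of the normed module 'rV[R]_N is the sup norm, so the Euclidean
   norm has to be introduced separately. *)
Definition enorm (R : realType) (N : nat) (x : 'rV[R]_N) : R :=
  Num.sqrt (\sum_(i < N) x 0 i ^+ 2).

Definition eball (R : realType) (N : nat) (rho : R) : set 'rV[R]_N :=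
  [set x | enorm x < rho].

Definition esphere (R : realType) (N : nat) (rho : R) : set 'rV[R]_N :=
  [set x | enorm x = rho].

Definition grad (R : realType) (N : nat) (U : 'rV[R]_N -> R) (x : 'rV[R]_N) :
    'rV[R]_N :=
  \row_(i < N) 'D_(delta_mx 0 i) U x.

Definition divergence (R : realType) (N : nat) (F : 'rV[R]_N -> 'rV[R]_N)
    (x : 'rV[R]_N) : R :=
  \sum_(i < N) 'D_(delta_mx 0 i) (fun y => F y 0 i) x.

Definition minkowski_flux (R : realType) (N : nat) (U : 'rV[R]_N -> R)
    (x : 'rV[R]_N) : 'rV[R]_N :=
  (Num.sqrt (1 - enorm (grad U x) ^+ 2))^-1 *: grad U x.

(* The outer normal derivative of U vanishes on the sphere of radius rho; U is
   only evaluated in the closed ball, the outer unit normal at x is x / rho. *)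
Definition neumann_bc (R : realType) (N : nat) (rho : R) (U : 'rV[R]_N -> R) :
    Prop :=
  forall x, esphere rho x ->
    (fun t : R => (U (x + t *: (rho^-1 *: x)) - U x) / t) @ 0^'- --> (0 : R).

(* u is C^2 on [0, rho] with |u'| < 1 there. *)
Definition classical_profile (R : realType) (rho : R) (u : R -> R) : Prop :=
  exists u' : R -> R,
    [/\ has_deriv_on `[0, rho] u u',
        C1_on `[0, rho] u' &
        forall r : R, 0 <= r <= rho -> `|u' r| < 1].

Definition radial_ext (R : realType) (N : nat) (u : R -> R) (x : 'rV[R]_N) : R :=
  u (enorm x).

(* u is the profile of a classical radial solution of the Neumann problem in
   the ball of radius rho of R^N.  Since 'D_v is a total operator, the
   differentiability of U and of the flux are required explicitly. *)
Definition radial_neumann_solution (R : realType) (N : nat) (f : R -> R)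
    (rho : R) (u : R -> R) : Prop :=
  let U := @radial_ext R N u in
  [/\ classical_profile rho u,
      forall x, eball rho x ->
        [/\ differentiable U x, differentiable (minkowski_flux U) x &
            - divergence (minkowski_flux U) x = f (U x)],
      forall x, eball rho x -> 0 < U x &
      neumann_bc rho U].

Definition non_constant_on (R : realType) (D : set R) (u : R -> R) : Prop :=
  exists r s, [/\ D r, D s & u r <> u s].

Definition distinct_on (R : realType) (D : set R) (u v : R -> R) : Prop :=
  exists2 r, D r & u r <> v r.

(* Main.v *)
(* In terms of the profile, put v = u' / sqrt (1 - u'^2), so that u' = psi v with
   psi v = v / sqrt (1 + v^2), and w = r^(N-1) v, so that w' = - r^(N-1) f(u).  A solution
   with u(0) = d, w(0) = 0 depends continuously on d, and for d <> 1 it never meets the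
   equilibrium (1, 0); hence (u - 1, - lam w) has a continuous polar angle theta_d, which
   is nondecreasing because f(u)(u - 1) >= 0 and w psi(v) >= 0.  The Neumann condition
   at R holds as soon as theta_d(R) = j pi, and then u - 1 has exactly j zeros in (0, R).

   The angle theta_d(R) stays below pi / 2 when d is close to 0, when d is close to 1 (as
   f'(1) = 0), and when d >= R + 2 (as |u'| < 1).  It exceeds k pi for some d < 1 and for
   some d > 1: fix a small energy level h and a large radius r0; by continuity some d on
   either side of 1 has energy sqrt (1 + v^2) - 1 + F(u) equal to h at r0.  For large r0
   friction is negligible on [r0, r0 + T], so the energy stays in [h / 2, h] there and the
   solution turns around (1, 0) with angular speed bounded below.  (A fixed d and R -> oo
   would not do: for supercritical f the solution may never oscillate.)  The intermediate
   value theorem on the four resulting intervals of d gives the 4k solutions. *)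
Require Import Defs.
From mathcomp Require Import ring lra zify.

Set Implicit Arguments.
Unset Strict Implicit.
Unset Printing Implicit Defensive.

Local Open Scope classical_set_scope.
Local Open Scope card_scope.
Local Open Scope ring_scope.

(** * Calculus on the real line *)

Section calculus.
Variable R : realType.
Implicit Types (f g h F G H : R -> R) (a b x : R).

(** The nonlinearity is only locally Lipschitz on a half-line, so for each rho it is replaced by a
    bounded, globally Lipschitz truncation; the bound |u'| < 1 keeps the relevant solutions below
    the truncation level on [0, rho], and positivity is recovered afterwards. The constants that
    determine R_k are fixed before this truncation, hence do not depend on rho. The unknown w is
    preferred to v because its equation is regular at r = 0 and free of the friction term, which
    makes the angle monotone. The scale lam is 1 / r0^(N-1): on the time window after r0 the
    rescaled weight lam r^(N-1) lies in [1, 2], so the rotation is comparable to that of the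
    autonomous system, while the angles at which an axis is crossed do not depend on lam. The angle
    is defined as a primitive of the angular speed rather than by lifting a path, so that its
    monotonicity and its continuity in d become estimates on an explicit quotient. *)

Lemma is_derive_add f g x a b : is_derive x 1 f a -> is_derive x 1 g b ->
  is_derive x 1 (fun y => f y + g y) (a + b).
Proof. by move=> fa gb; have := is_deriveD fa gb. Qed.

Lemma is_derive_opp f x a : is_derive x 1 f a ->
  is_derive x 1 (fun y => - f y) (- a).
Proof. by move=> fa; have := is_deriveN fa. Qed.

Lemma is_derive_mul f g x a b : is_derive x 1 f a -> is_derive x 1 g b ->
  is_derive x 1 (fun y => f y * g y) (a * g x + f x * b).
Proof.
move=> fa gb; have := is_deriveM fa gb.
by move=> h; apply: (is_derive_eq h); rewrite /GRing.scale /=; ring.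
Qed.

Lemma is_derive_const (c x : R) : is_derive x 1 (fun _ : R => c) (0 : R).
Proof. exact: is_derive_cst. Qed.

Lemma is_derive_inv f x a : is_derive x 1 f a -> f x != 0 ->
  is_derive x 1 (fun y => (f y)^-1) (- a / f x ^+ 2).
Proof.
move=> fa f0; have h := is_deriveV f0 fa.
by apply: (is_derive_eq h); rewrite /GRing.scale /=; ring.
Qed.

Lemma is_derive_pow f n x a : is_derive x 1 f a ->
  is_derive x 1 (fun y => f y ^+ n) (n%:R * f x ^+ n.-1 * a).
Proof.
move=> fa; have := is_deriveX n fa; congr is_derive.
by apply/funext => y; rewrite exprfctE.
Qed.

Lemma is_derive_composite f g x a b : is_derive (g x) 1 f a -> is_derive x 1 g b ->
  is_derive x 1 (fun y => f (g y)) (a * b).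
Proof. by move=> fa gb; have := is_derive1_comp fa gb. Qed.

Lemma is_derive_continuous f x a : is_derive x 1 f a -> {for x, continuous f}.
Proof.
by move=> fa; apply: differentiable_continuous; apply/derivable1_diffP; case: fa.
Qed.

Lemma is_derive_within f g a b : (forall x, a <= x <= b -> is_derive x 1 f (g x)) ->
  {within `[a, b], continuous f}.
Proof.
move=> fg; apply: derivable_within_continuous => x; rewrite in_itv => /fg fx.
by case: fx.
Qed.

Lemma MVT_is_derive f g a b : a < b ->
  (forall x, a <= x <= b -> is_derive x 1 f (g x)) ->
  exists2 c, a < c < b & f b - f a = g c * (b - a).
Proof.
move=> ab fg; have dfg x : x \in `]a, b[ -> is_derive x 1 f (g x).
  by rewrite in_itv /= => /andP[ax xb]; apply: fg; rewrite !ltW.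
have [c cab E] := MVT ab dfg (is_derive_within fg).
by exists c.
Qed.

(** Bounds on derivatives become bounds on increments, which lets the later estimates avoid
    integrals. *)
Lemma is_derive_le f g F G a b : a <= b ->
  (forall x, a <= x <= b -> is_derive x 1 F (f x)) ->
  (forall x, a <= x <= b -> is_derive x 1 G (g x)) ->
  (forall x, a < x < b -> f x <= g x) -> F b - F a <= G b - G a.
Proof.
rewrite le_eqVlt => /predU1P[->|ab] dF dG fg; first by rewrite !subrr.
have [|c cab E] := @MVT_is_derive (fun x => G x + - F x) (fun x => g x + - f x) a b ab.
  by move=> x xab; apply: is_derive_add; [exact: dG | apply: is_derive_opp; exact: dF].
have : 0 <= (g c + - f c) * (b - a).
  by rewrite mulr_ge0 ?subr_ge0 ?fg// ltW.
by rewrite -E; lra.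
Qed.

Lemma is_derive_ge0 f F a b : a <= b ->
  (forall x, a <= x <= b -> is_derive x 1 F (f x)) ->
  (forall x, a < x < b -> 0 <= f x) -> F a <= F b.
Proof.
move=> ab dF f0.
have := is_derive_le ab (fun x _ => is_derive_const 0 x) dF f0.
by rewrite subrr subr_ge0.
Qed.

Lemma is_derive_eq0 F a b : a <= b ->
  (forall x, a <= x <= b -> is_derive x 1 F 0) -> F a = F b.
Proof.
move=> ab dF; apply/eqP; rewrite eq_le (is_derive_ge0 ab dF)//=.
have := is_derive_le ab dF (fun x _ => is_derive_const 0 x) (fun _ _ => lexx _).
by rewrite subrr subr_le0.
Qed.

Lemma is_derive_norm_le f g F G a b : a <= b ->
  (forall x, a <= x <= b -> is_derive x 1 F (f x)) ->
  (forall x, a <= x <= b -> is_derive x 1 G (g x)) ->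
  (forall x, a < x < b -> `|f x| <= g x) -> `|F b - F a| <= G b - G a.
Proof.
move=> ab dF dG fg; rewrite ler_norml (is_derive_le ab dF dG) ?andbT; last first.
  by move=> x /fg; apply: le_trans; exact: ler_norm.
have dG' x : a <= x <= b -> is_derive x 1 (fun y => - G y) (- g x).
  by move=> xab; apply: is_derive_opp; exact: dG.
have := is_derive_le ab dG' dF; suff fg' : forall x, a < x < b -> - g x <= f x.
  by move=> /(_ fg'); lra.
by move=> x /fg; rewrite ler_norml => /andP[].
Qed.

Let mu := @lebesgue_measure R.

(** Integration starts at -1 so that 0 is interior to the half-line where the derivative is
    known. *)
Let right_primitive h : continuous h ->
  exists2 P : R -> R, P 0 = 0 & forall x, -1 < x -> is_derive x 1 P (h x).
Proof.
move=> ch; exists (fun x => \int[mu]_(t in `[-1, x]) h t - \int[mu]_(t in `[-1, 0]) h t).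
  by rewrite subrr.
move=> x x1; set F := (fun x => \int[mu]_(t in `[-1, x]) h t).
have xx1 : x < x + 1 by rewrite ltrDl.
have hint : mu.-integrable `[-1, x + 1] (EFin \o h).
  apply: continuous_compact_integrable; first exact: segment_compact.
  exact: continuous_subspaceT.
have [dF EF] := continuous_FTC1_closed xx1 hint x1 (ch x).
have dF' : is_derive x 1 F (h x).
  by rewrite -EF derive1E; exact: derivableP.
by have := is_derive_add dF' (is_derive_const (- F 0) x); rewrite addr0.
Qed.

(** The half-line primitives of [h] and of its reflection agree on (-1, 1), so they glue at 0. *)
Lemma ex_primitive h : continuous h ->
  exists H : R -> R, H 0 = 0 /\ forall x, is_derive x 1 H (h x).
Proof.
move=> ch; have [P P0 dP] := right_primitive ch.
have chN : continuous (fun x => h (- x)).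
  by move=> x; apply: continuous_comp; [exact: oppr_continuous|exact: ch].
have [Q Q0 dQ] := right_primitive chN.
have dQN (x : R) : x < 1 -> is_derive x 1 (fun y => - Q (- y)) (h x).
  move=> x1; have /dQ dQx : -1 < - x by lra.
  have := is_derive_opp (is_derive_composite dQx (is_derive_opp (is_derive_id x 1))).
  by rewrite opprK mulrN1 opprK.
have PQ (x : R) : -1 < x < 1 -> P x = - Q (- x).
  move=> x1; pose D (y : R) : R := P y + - (- Q (- y)).
  have dD (y : R) : -1 < y < 1 -> is_derive y 1 D 0.
    move=> /andP[y1 y2]; rewrite -(subrr (h y)).
    by apply: is_derive_add; [exact: dP|apply: is_derive_opp; exact: dQN].
  have : D x = D 0.
    have [x0|/ltW x0] := leP x 0.
      by apply: is_derive_eq0 => // y y0; apply: dD; lra.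
    by symmetry; apply: is_derive_eq0 => // y y0; apply: dD; lra.
  by rewrite /D P0 oppr0 Q0; lra.
exists (fun x : R => if 0 <= x then P x else - Q (- x)); rewrite lexx; split=> // x.
have [x0|x0] := leP 0 x.
  apply: (@near_eq_is_derive _ _ _ P); last by apply: dP; lra.
  have : \forall y \near x, -1 < y by apply: lt_nbhsr; lra.
  apply: filterS => y y1.
  by case: leP => // y0; rewrite PQ//; apply/andP; split; lra.
apply: (@near_eq_is_derive _ _ _ (fun y => - Q (- y))); last by apply: dQN; lra.
have : \forall y \near x, y < 1 by apply: lt_nbhsl; lra.
apply: filterS => y y1.
by case: leP => // y0; rewrite PQ//; apply/andP; split; lra.
Qed.

Definition primitive h : R -> R :=
  xget (fun=> 0) [set H : R -> R | H 0 = 0 /\ forall x, is_derive x 1 H (h x)].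

Lemma primitive_spec h : continuous h ->
  primitive h 0 = 0 /\ forall x, is_derive x 1 (primitive h) (h x).
Proof.
move=> ch; have [H HP] := ex_primitive ch.
exact: (@xgetPex _ (fun=> 0) [set H : R -> R | H 0 = 0 /\ forall x, is_derive x 1 H (h x)]
  (ex_intro _ H HP)).
Qed.

Lemma primitive0 h : continuous h -> primitive h 0 = 0.
Proof. by move=> /primitive_spec[]. Qed.

Lemma is_derive_primitive h x : continuous h -> is_derive x 1 (primitive h) (h x).
Proof. by move=> /primitive_spec[]. Qed.

End calculus.

(** * The function psi *)

Section psi.
Variable R : realType.
Implicit Types a b v : R.

Definition psi v : R := v / Num.sqrt (1 + v ^+ 2).

Lemma sqrt1D_sq v : Num.sqrt (1 + v ^+ 2) ^+ 2 = 1 + v ^+ 2.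
Proof. by rewrite sqr_sqrtr// addr_ge0// sqr_ge0. Qed.

Lemma sqrt1D_gt0 v : 0 < Num.sqrt (1 + v ^+ 2).
Proof. by rewrite sqrtr_gt0 ltr_pwDl// sqr_ge0. Qed.

Lemma sqrt1D_ge1 v : 1 <= Num.sqrt (1 + v ^+ 2).
Proof. by rewrite -{1}(@sqrtr1 R) ler_wsqrtr// lerDl sqr_ge0. Qed.

Lemma psiE v : v = psi v * Num.sqrt (1 + v ^+ 2).
Proof. by rewrite /psi divfK// gt_eqF// sqrt1D_gt0. Qed.

Lemma psi0 : psi 0 = 0.
Proof. by rewrite /psi mul0r. Qed.

Lemma psi_eq0 v : (psi v == 0) = (v == 0).
Proof. by rewrite /psi mulf_eq0 invr_eq0 (gt_eqF (sqrt1D_gt0 v)) orbF. Qed.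

Lemma psi_norm_lt1 v : `|psi v| < 1.
Proof.
rewrite /psi normrM normfV (gtr0_norm (sqrt1D_gt0 v)) ltr_pdivrMr ?sqrt1D_gt0// mul1r.
rewrite -(@ltr_pXn2r _ 2) ?nnegrE ?normr_ge0 ?ltW ?sqrt1D_gt0//.
by rewrite sqrt1D_sq real_normK ?num_real//; lra.
Qed.

Lemma psi_norm_le v : `|psi v| <= `|v|.
Proof.
rewrite /psi normrM normfV (gtr0_norm (sqrt1D_gt0 v)).
by rewrite ler_piMr// invf_le1 ?sqrt1D_gt0// sqrt1D_ge1.
Qed.

(** It relates the dissipation [v * psi v] to the kinetic energy [sqrt (1 + v^2) - 1]. *)
Lemma mul_psi v : v * psi v = Num.sqrt (1 + v ^+ 2) - (Num.sqrt (1 + v ^+ 2))^-1.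
Proof.
have s0 := lt0r_neq0 (sqrt1D_gt0 v); have sq := sqrt1D_sq v.
rewrite /psi mulrA -expr2 (_ : v ^+ 2 = Num.sqrt (1 + v ^+ 2) ^+ 2 - 1); last by rewrite sq; ring.
set s := Num.sqrt _ in s0 *; rewrite (_ : Num.sqrt _ = s); last by congr Num.sqrt; rewrite sq; ring.
by field.
Qed.

Lemma mul_psi_ge0 v : 0 <= v * psi v.
Proof. by rewrite /psi mulrA -expr2 divr_ge0 ?sqr_ge0// ltW// sqrt1D_gt0. Qed.

Lemma mul_psi_gt0 v : v != 0 -> 0 < v * psi v.
Proof. by move=> v0; rewrite lt_neqAle mul_psi_ge0 eq_sym mulf_neq0// psi_eq0. Qed.

(** Since [psi] is the derivative of the kinetic energy, [sqrt (1 + v^2) - 1 + F(u)] would be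
    conserved without friction. *)
Lemma is_derive_sqrt1D v :
  is_derive v 1 (fun y : R => Num.sqrt (1 + y ^+ 2)) (psi v).
Proof.
have h0 : 0 < 1 + v ^+ 2 by rewrite ltr_pwDl// sqr_ge0.
have h1 := is_derive_add (is_derive_const 1 v) (is_derive_pow 2 (is_derive_id v (1 : R))).
have h := @is_derive_composite _ Num.sqrt (fun y : R => 1 + y ^+ 2) _ _ _ (is_derive1_sqrt h0) h1.
apply: (is_derive_eq h).
rewrite /psi; have := lt0r_neq0 (sqrt1D_gt0 v).
by set s := Num.sqrt _ => s0; rewrite /=; field.
Qed.

Lemma is_derive_psi v : is_derive v 1 psi ((Num.sqrt (1 + v ^+ 2))^-1 ^+ 3).
Proof.
have s0 := lt0r_neq0 (sqrt1D_gt0 v).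
have h := is_derive_mul (is_derive_id v (1 : R)) (is_derive_inv (is_derive_sqrt1D v) s0).
apply: (is_derive_eq h).
rewrite /psi; have := sqrt1D_sq v; move: s0.
set s := Num.sqrt _ => s0 sq.
rewrite (_ : _ + _ = (s ^+ 2 - v ^+ 2) / s ^+ 3); last by field.
by rewrite sq; field.
Qed.

Lemma continuous_psi : continuous psi.
Proof. by move=> v; exact: is_derive_continuous (is_derive_psi v). Qed.

Lemma psi_lipschitz a b : `|psi a - psi b| <= `|a - b|.
Proof.
wlog ab : a b / b <= a.
  move=> H; have [/H//|/ltW/H] := leP b a; by rewrite distrC (distrC b).
rewrite (ger0_norm (_ : 0 <= a - b)) ?subr_ge0//.
apply: (is_derive_norm_le ab (fun x _ => is_derive_psi x)
  (fun x _ => is_derive_id x (1 : R))) => x _.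
have s1 := sqrt1D_ge1 x; have s0 := sqrt1D_gt0 x.
have i0 : 0 <= (Num.sqrt (1 + x ^+ 2))^-1 by rewrite invr_ge0 ltW.
rewrite /= ger0_norm; last exact: exprn_ge0.
by apply: exprn_ile1 => //; rewrite invf_le1.
Qed.

(** [psi] inverts the map [s / sqrt (1 - s^2)]; this brings the flux of a radial function back to
    [v]. *)
Lemma psi_flux v : (Num.sqrt (1 - psi v ^+ 2))^-1 * psi v = v.
Proof.
have s0 := lt0r_neq0 (sqrt1D_gt0 v).
suff -> : Num.sqrt (1 - psi v ^+ 2) = (Num.sqrt (1 + v ^+ 2))^-1.
  by rewrite invrK mulrC -psiE.
rewrite -[RHS]ger0_norm ?invr_ge0 ?ltW ?sqrt1D_gt0// -sqrtr_sqr; congr Num.sqrt.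
rewrite /psi exprMn exprVn; have := sqrt1D_sq v; move: s0.
set s := Num.sqrt _ => s0 sq; have -> : v ^+ 2 = s ^+ 2 - 1 by rewrite sq; ring.
by field.
Qed.

End psi.

(** * Limits with errors that halve at each step *)

Section geometric.
Variable R : realType.

Lemma le_geometric (x y c : R) : (forall k, x <= y + c / 2 ^+ k) -> x <= y.
Proof.
move=> h; apply/ler_addgt0Pl => e e0.
have c2 : (fun k => c / 2 ^+ k) @ \oo --> (0 : R).
  rewrite -(mulr0 c); apply: cvgMr; under eq_fun do rewrite -exprVn.
  by apply: cvg_expr; rewrite ger0_norm ?invr_ge0 ?ler0n// invf_lt1 ?ltr1n.
have /cvgrPdist_lt /(_ e e0) [k _ /(_ k (leqnn k))] := c2.
rewrite sub0r normrN => ce; apply: (le_trans (h k)).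
by rewrite addrC lerD2r; apply: le_trans (ltW ce); exact: ler_norm.
Qed.

(** The intervals of radius [2 * c / 2 ^+ k] around [a k] are nested; the limit is the supremum of
    their left end points. *)
Lemma geometric_limit (a : nat -> R) (c : R) :
  (forall k, `|a k.+1 - a k| <= c / 2 ^+ k) ->
  exists l, forall k, `|a k - l| <= 2 * c / 2 ^+ k.
Proof.
move=> h.
have p k : 2 ^+ k.+1 = 2 * 2 ^+ k :> R by rewrite exprS.
have n0 k : (2 : R) ^+ k != 0 by rewrite expf_neq0// pnatr_eq0.
have e k : 2 * c / 2 ^+ k.+1 = c / 2 ^+ k by rewrite p; field.
have e2 k : 2 * c / 2 ^+ k = c / 2 ^+ k + c / 2 ^+ k by field.
have mono k m : a k - 2 * c / 2 ^+ k <= a (k + m)%N - 2 * c / 2 ^+ (k + m).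
  elim: m => [|m IH]; first by rewrite addn0.
  apply: le_trans IH _; rewrite addnS e e2; have := h (k + m)%N.
  by rewrite ler_norml => /andP[]; lra.
have anti k m : a (k + m)%N + 2 * c / 2 ^+ (k + m) <= a k + 2 * c / 2 ^+ k.
  elim: m => [|m IH]; first by rewrite addn0.
  apply: le_trans IH; rewrite addnS e e2; have := h (k + m)%N.
  by rewrite ler_norml => /andP[]; lra.
have c0 k : 0 <= 2 * c / 2 ^+ k.
  by have := h k; rewrite e2; have := normr_ge0 (a k.+1 - a k); lra.
have lu j k : a j - 2 * c / 2 ^+ j <= a k + 2 * c / 2 ^+ k.
  have [jk|/ltnW jk] := leqP j k.
    by have := mono j (k - j)%N; rewrite subnKC//; have := c0 k; lra.
  by have := anti k (j - k)%N; rewrite subnKC//; have := c0 j; lra.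
pose S := [set a k - 2 * c / 2 ^+ k | k in [set: nat]].
have S0 : S !=set0 by exists (a 0%N - 2 * c / 2 ^+ 0), 0%N.
exists (sup S) => k; rewrite distrC ler_distl; apply/andP; split.
  by apply: ub_le_sup; [exists (a 0%N + 2 * c / 2 ^+ 0) => _ [j _ <-]; exact: lu|exists k].
by apply: ge_sup => // _ [j _ <-]; exact: lu.
Qed.

End geometric.

(** * The radial initial value problem *)

Section continuity.
Variable R : realType.
Implicit Types f g : R -> R.

Lemma continuous_add f g : continuous f -> continuous g ->
  continuous (fun x => f x + g x).
Proof. by move=> cf cg x; apply: continuousD; [exact: cf|exact: cg]. Qed.

Lemma continuous_opp f : continuous f -> continuous (fun x => - f x).
Proof. by move=> cf x; apply: continuousN; exact: cf. Qed.

Lemma continuous_mul f g : continuous f -> continuous g ->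
  continuous (fun x => f x * g x).
Proof. by move=> cf cg x; apply: continuousM; [exact: cf|exact: cg]. Qed.

Lemma continuous_pow f n : continuous f -> continuous (fun x => f x ^+ n).
Proof.
move=> cf x; apply: (@continuous_comp _ _ _ f (fun y => y ^+ n)); first exact: cf.
exact: exprn_continuous.
Qed.

Lemma continuous_const (c : R) : continuous (fun _ : R => c).
Proof. by move=> x; exact: cvg_cst. Qed.

Lemma continuous_composite f g : continuous f -> continuous g ->
  continuous (fun x => f (g x)).
Proof. by move=> cf cg x; apply: continuous_comp; [exact: cg|exact: cf]. Qed.

Lemma continuous_lipschitz f (K x : R) : (forall y, `|f y - f x| <= K * `|y - x|) ->
  {for x, continuous f}.
Proof.
move=> h; apply/cvgrPdist_le => e e0; have K0 : 0 < `|K| + 1 by rewrite ltr_wpDl.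
have : \forall y \near x, `|x - y| < e / (`|K| + 1).
  by apply: nbhsx_ballx; rewrite divr_gt0.
apply: filterS => y; rewrite ltr_pdivlMr// => xy; rewrite distrC.
apply: le_trans (h y) _; apply: le_trans (ltW xy).
rewrite distrC mulrC ler_wpM2l//; have := ler_norm K; lra.
Qed.

Lemma near_eq_continuous f g (x : R) : (\forall y \near x, f y = g y) ->
  {for x, continuous g} -> {for x, continuous f}.
Proof.
move=> fg cg; have fgx : f x = g x by exact: nbhs_singleton fg.
rewrite /prop_for /continuous_at fgx; apply: cvg_trans cg.
by apply: near_eq_cvg; apply: filterS fg.
Qed.

End continuity.

Section picard.
Variables (R : realType) (n : nat) (g : R -> R).
Implicit Types (d r s t A B : R) (x u v w : R -> R).

(* One Picard iteration [x |-> u] for the system [u' = psi v], [w = r^n v],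
   [w' = - r^n g(x)]; its fixed points [x = u] are the solutions of the radial
   problem.  Extending [v] by 0 to negative [r] makes [u] differentiable on the whole
   line. *)
Record radial_step d x u v w : Prop := RadialStep {
  step_u0 : u 0 = d;
  step_u : forall r, is_derive r 1 u (psi (v r));
  step_w0 : w 0 = 0;
  step_w : forall r, is_derive r 1 w (- (r ^+ n * g (x r)));
  step_wv : forall r, 0 <= r -> w r = r ^+ n * v r;
  step_v : continuous v;
  step_vN : forall r, r <= 0 -> v r = 0 }.

Definition radial_solution d u v w := radial_step d u u v w.

(** [|psi| < 1] gives a speed bound independent of [g] and [x]; it later keeps solutions below the
    truncation level. *)
Lemma step_unit_speed d x u v w r s : radial_step d x u v w -> `|u r - u s| <= `|r - s|.
Proof.
move=> S; wlog sr : r s / s <= r.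
  move=> H; have [/H//|/ltW/H] := leP s r; by rewrite distrC (distrC s).
rewrite (ger0_norm (_ : 0 <= r - s)) ?subr_ge0//.
have := is_derive_norm_le sr (fun y _ => step_u S y) (fun t _ => is_derive_id t (1 : R)).
by apply => y _; rewrite ltW// psi_norm_lt1.
Qed.

Lemma step_continuous d x u v w : radial_step d x u v w -> continuous u.
Proof. by move=> S y; exact: is_derive_continuous (step_u S y). Qed.

Lemma step_uN d x u v w r : radial_step d x u v w -> r <= 0 -> u r = d.
Proof.
move=> S r0; rewrite -(step_u0 S); apply: is_derive_eq0 => // y /andP[_ y0].
by have := step_u S y; rewrite (step_vN S)// psi0.
Qed.

(** The weight [t ^+ n] is at most [s ^+ n] on [[0, s]], so [w - w'] is at most [s ^+ n * B * s];
    dividing by [s ^+ n] leaves no singularity at 0. *)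
Lemma step_v_dist d x u v w d' x' u' v' w' s B :
  radial_step d x u v w -> radial_step d' x' u' v' w' -> 0 <= s ->
  (forall t, 0 <= t <= s -> `|g (x t) - g (x' t)| <= B) ->
  `|v s - v' s| <= B * s.
Proof.
move=> S S' s0 h; have [->|sN0] := eqVneq s 0.
  by rewrite (step_vN S)// (step_vN S')// subrr normr0 mulr0.
have sp : 0 < s ^+ n by rewrite exprn_gt0// lt_neqAle eq_sym sN0.
rewrite -(ler_pM2l sp) -{1}(gtr0_norm sp) -normrM mulrBr.
rewrite -(step_wv S)// -(step_wv S')//.
have dw t : is_derive t 1 (fun t => w t + - w' t) (- (t ^+ n * g (x t)) + - - (t ^+ n * g (x' t))).
  by apply: is_derive_add; [exact: step_w S t|apply: is_derive_opp; exact: step_w S' t].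
have dG t : is_derive t 1 (fun t => s ^+ n * B * t) (s ^+ n * B).
  by have := is_derive_mul (is_derive_const (s ^+ n * B) t) (is_derive_id t (1:R)); rewrite mul0r add0r mulr1.
have := is_derive_norm_le s0 (fun t _ => dw t) (fun t _ => dG t).
rewrite (step_w0 S) (step_w0 S') !subr0 mulr0 subr0 mulrA; apply => t /andP[t0 ts].
rewrite opprK -mulrN addrC -mulrDr normrM normrX (gtr0_norm t0) distrC.
by apply: ler_pM => //; [rewrite exprn_ge0// ltW|rewrite lerXn2r// ?nnegrE// ltW|apply: h; rewrite !ltW].
Qed.

Variables (C L : R).
Hypothesis L0 : 0 < L.
Hypothesis gC : forall y, `|g y| <= C.
Hypothesis gL : forall y z, `|g y - g z| <= L * `|y - z|.

(** Weight of a Bielecki norm, in which the Picard map contracts by 1/2 on every interval, whatever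
    its length. *)
Let wt r : R := expR (L * r ^+ 2).

Let wt_ge1 r : 1 <= wt r.
Proof. by rewrite /wt; apply: le_trans (expR_ge1Dx _); rewrite lerDl mulr_ge0 ?sqr_ge0 ?ltW. Qed.

Let wt_le r s : 0 <= r -> r <= s -> wt r <= wt s.
Proof.
move=> r0 rs; rewrite /wt ler_expR ler_pM2l// lerXn2r// nnegrE//; exact: le_trans rs.
Qed.

(** [A / 2 * wt t] has derivative [A * L * t * wt t], exactly the bound that [step_v_dist] gives for
    the difference of the speeds. *)
Lemma step_contraction d x u v w d' x' u' v' w' s A :
  radial_step d x u v w -> radial_step d' x' u' v' w' -> 0 <= A ->
  (forall t, 0 <= t <= s -> `|x t - x' t| <= A * wt t) ->
  forall r, 0 <= r <= s -> `|u r - u' r| <= `|d - d'| + A / 2 * (wt r - 1).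
Proof.
move=> S S' A0 h r /andP[r0 rs].
have du t : is_derive t 1 (fun t => u t + - u' t) (psi (v t) + - psi (v' t)).
  by apply: is_derive_add; [exact: step_u S t|apply: is_derive_opp; exact: step_u S' t].
have dG (t : R) : is_derive t 1 (fun t => A / 2 * wt t) (A * L * t * wt t).
  have h1 := is_derive_mul (is_derive_const L t) (is_derive_pow 2 (is_derive_id t (1 : R))).
  have h2 := @is_derive_composite _ expR (fun t => L * t ^+ 2) _ _ _ (is_derive_expR _) h1.
  have := is_derive_mul (is_derive_const (A / 2) t) h2.
  by move=> h3; apply: (is_derive_eq h3); rewrite /wt /=; field.
have wt0 : wt 0 = 1 by rewrite /wt expr0n mulr0 expR0.
have H0 t : 0 < t < r -> `|psi (v t) + - psi (v' t)| <= A * L * t * wt t.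
  move=> /andP[t0 tr]; apply: le_trans (psi_lipschitz _ _) _.
  rewrite (_ : A * L * t * wt t = (L * (A * wt t)) * t); last by ring.
  apply: (step_v_dist S S' (ltW t0)) => y /andP[y0 yt].
  apply: le_trans (gL _ _) _; rewrite ler_pM2l//; apply: le_trans (h y _) _.
    by rewrite y0/=; lra.
  by rewrite ler_wpM2l// wt_le.
have := is_derive_norm_le r0 (fun t _ => du t) (fun t _ => dG t) H0.
rewrite (step_u0 S) (step_u0 S') wt0 => H.
have := ler_normD (u r - u' r - (d - d')) (d - d').
by rewrite subrK; lra.
Qed.

(** The speed bound gives the crude estimate [M]; each use of the contraction halves the part of it
    in excess of [2 * |d - d'|]. The case [d = d'] is uniqueness. *)
Lemma solution_dependence d u v w d' u' v' w' r :
  radial_solution d u v w -> radial_solution d' u' v' w' -> 0 <= r ->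
  `|u r - u' r| <= 2 * `|d - d'| * expR (L * r ^+ 2).
Proof.
move=> S S' r0; rewrite -/(wt r).
pose M := `|d - d'| + 2 * r; have M0 : 0 <= M by rewrite addr_ge0 ?mulr_ge0.
suff H k t : 0 <= t <= r -> `|u t - u' t| <= (2 * `|d - d'| + M / 2 ^+ k) * wt t.
  apply: (@le_geometric _ _ _ (M * wt r)) => k.
  have := H k r; rewrite r0 lexx => /(_ isT); rewrite mulrDl.
  by rewrite (mulrAC M).
elim: k t => [|k IH] t /andP[t0 tr].
  rewrite expr0 divr1; apply: (@le_trans _ _ (`|d - d'| + 2 * r)).
    have := step_unit_speed t 0 S; have := step_unit_speed t 0 S'.
    rewrite (step_u0 S) (step_u0 S') subr0 (ger0_norm t0).
    have := ler_normD ((u t - d) + (d' - u' t)) (d - d').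
    have := ler_normD (u t - d) (d' - u' t); rewrite (distrC d').
    rewrite (_ : _ + (d - d') = u t - u' t); last by ring.
    by lra.
  have dd := normr_ge0 (d - d').
  rewrite -/M; apply: (@le_trans _ _ (M * 1)); first by rewrite mulr1.
  apply: ler_pM => //; lra.
have A0 : 0 <= 2 * `|d - d'| + M / 2 ^+ k.
  by rewrite addr_ge0 ?mulr_ge0 ?invr_ge0 ?exprn_ge0.
apply: le_trans (step_contraction S S' A0 IH (_ : 0 <= t <= r)) _; first by rewrite t0.
rewrite exprS invfM; have w1 := wt_ge1 t; have dd := normr_ge0 (d - d').
set e := M / 2 ^+ k; have e0 : 0 <= e by rewrite divr_ge0 ?exprn_ge0.
rewrite (mulrCA M) -/e; set q := wt t in w1 *.
have dq : 0 <= `|d - d'| * q by rewrite mulr_ge0//; lra.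
by move: dq e0; set D := `|d - d'|; lra.
Qed.

End picard.

Section existence.
Variables (R : realType) (n : nat) (g : R -> R) (C L : R).
Hypothesis L0 : 0 < L.
Hypothesis gC : forall y, `|g y| <= C.
Hypothesis gL : forall y z, `|g y - g z| <= L * `|y - z|.
Implicit Types (d r s t A B : R) (x u v w : R -> R).

Let cg : continuous g.
Proof. by move=> y; apply: continuous_lipschitz => z; exact: gL. Qed.

(** Two successive primitives give [w], then [u]. Boundedness of [g] enters through
    [|v t| <= C * |t|], which makes [v] continuous at the singular point 0. *)
Lemma ex_radial_step d x : continuous x -> exists u v w, radial_step n g d x u v w.
Proof.
move=> cx; pose q t := t ^+ n * g (x t).
have cq : continuous q.
  apply: continuous_mul; last exact: continuous_composite.
  by apply: continuous_pow => y; exact: cvg_id.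
pose w t := - primitive q t.
have dw t : is_derive t 1 w (- q t) by apply: is_derive_opp; exact: is_derive_primitive.
have w0 : w 0 = 0 by rewrite /w primitive0// oppr0.
pose v t := if t <= 0 then 0 else w t / t ^+ n.
have vN t : t <= 0 -> v t = 0 by rewrite /v => ->.
have wv t : 0 <= t -> w t = t ^+ n * v t.
  rewrite le_eqVlt => /predU1P[<-|t0]; first by rewrite w0 vN// mulr0.
  by rewrite /v leNgt t0/= mulrC divfK// expf_neq0// gt_eqF.
have vC t : `|v t| <= C * `|t|.
  have C0 : 0 <= C by apply: le_trans (gC 0).
  have [t0|t0] := leP t 0; first by rewrite vN// normr0 mulr_ge0.
  have tp : 0 < t ^+ n by rewrite exprn_gt0.
  rewrite -(ler_pM2l tp) -{1}(gtr0_norm tp) -normrM -wv ?(ltW t0)// (gtr0_norm t0).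
  have dG s : is_derive s 1 (fun s => t ^+ n * C * s) (t ^+ n * C).
    by have := is_derive_mul (is_derive_const (t ^+ n * C) s) (is_derive_id s (1:R)); rewrite mul0r add0r mulr1.
  have := is_derive_norm_le (ltW t0) (fun s _ => dw s) (fun s _ => dG s).
  rewrite w0 mulr0 !subr0 mulrA; apply => s /andP[s0 st].
  rewrite normrN normrM normrX (gtr0_norm s0); apply: ler_pM => //.
    by rewrite exprn_ge0// ltW.
  by rewrite lerXn2r// ?nnegrE// ltW.
have cv : continuous v.
  move=> t; have [t0|t0|->] := ltgtP t 0.
  - apply: (@near_eq_continuous _ v (fun=> 0)); last exact: cvg_cst.
    by apply: filterS (lt_nbhsl t0) => y y0; rewrite vN// ltW.
  - apply: (@near_eq_continuous _ v (fun t => w t * (t ^+ n)^-1)).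
      by apply: filterS (lt_nbhsr t0) => y y0; rewrite /v leNgt y0.
    have tn0 : t ^+ n != 0 by rewrite expf_neq0// gt_eqF.
    have dt := is_derive_inv (is_derive_pow n (is_derive_id t (1 : R))) tn0.
    exact: is_derive_continuous (is_derive_mul (dw t) dt).
  - by apply: (@continuous_lipschitz _ v C) => y; rewrite (vN 0)// !subr0; exact: vC.
have cpv : continuous (fun t => psi (v t)).
  by apply: continuous_composite => //; exact: continuous_psi.
exists (fun t => d + primitive (fun t => psi (v t)) t), v, w; split => //.
- by rewrite primitive0// addr0.
- move=> r; have := is_derive_add (is_derive_const d r) (is_derive_primitive r cpv).
  by rewrite add0r.
Qed.

Let T d x := xget (fun=> d) [set u | exists v w, radial_step n g d x u v w].
Let U d k := iter k (T d) (fun=> d).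

Let continuous_U d k : continuous (U d k).
Proof.
elim: k => [|k IH]; first exact: continuous_const.
have [v [w S]] := @xgetPex _ (fun=> d) _ (ex_radial_step d IH).
exact: step_continuous S.
Qed.

Let step_U d k : exists v w, radial_step n g d (U d k) (U d k.+1) v w.
Proof. exact: (@xgetPex _ (fun=> d) _ (ex_radial_step d (@continuous_U d k))). Qed.

Let U_increment d k s r : 0 <= r <= s ->
  `|U d k.+1 r - U d k r| <= s * expR (L * s ^+ 2) / 2 ^+ k.
Proof.
move=> /andP[r0 rs]; have s0 : 0 <= s by exact: le_trans rs.
suff H t : 0 <= t <= s -> `|U d k.+1 t - U d k t| <= s / 2 ^+ k * expR (L * t ^+ 2).
  apply: le_trans (H r _) _; first by rewrite r0.
  rewrite mulrAC ler_wpM2r ?invr_ge0 ?exprn_ge0// ler_wpM2l//.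
  by rewrite ler_expR ler_pM2l// lerXn2r// nnegrE.
elim: k t => [|k IH] t /andP[t0 ts].
  have [v [w S]] := step_U d 0.
  have := step_unit_speed t 0 S; rewrite (step_u0 S) subr0 (ger0_norm t0) => h.
  apply: le_trans h _; rewrite expr0 divr1.
  have e1 : 1 <= expR (L * t ^+ 2).
    by apply: le_trans (expR_ge1Dx _); rewrite lerDl mulr_ge0 ?sqr_ge0 ?ltW.
  by apply: le_trans ts _; rewrite ler_peMr.
have [v [w S]] := step_U d k; have [v' [w' S']] := step_U d k.+1.
have A0 : 0 <= s / 2 ^+ k by rewrite divr_ge0 ?exprn_ge0.
have := step_contraction L0 gL S' S A0 IH; move=> /(_ t); rewrite t0 ts => /(_ isT) h.
apply: le_trans h _; rewrite subrr normr0 add0r (exprS 2 k) invfM.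
rewrite (_ : s * (2^-1 / 2 ^+ k) = s / 2 ^+ k / 2); last by ring.
by apply: ler_wpM2l; [rewrite divr_ge0|rewrite gerBl].
Qed.

(** The pointwise limit [u] of the iterates is 1-Lipschitz, hence admits one further step [u']; the
    contraction shows that the iterates also tend to [u']. *)
Lemma ex_radial_solution d : exists u v w, radial_solution n g d u v w.
Proof.
have UN j r : r <= 0 -> U d j r = d.
  by case: j => [//|j]; have [v [w S]] := step_U d j; exact: step_uN S.
pose K r := `|r| * expR (L * `|r| ^+ 2).
have UK k r : `|U d k.+1 r - U d k r| <= K r / 2 ^+ k.
  have [r0|r0] := leP 0 r.
    by rewrite /K (ger0_norm r0); apply: U_increment; rewrite r0 lexx.
  by rewrite !UN ?(ltW r0)// subrr normr0 divr_ge0 ?exprn_ge0// mulr_ge0// expR_ge0.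
have /choice[u Hu] : forall r, exists l, forall k, `|U d k r - l| <= 2 * K r / 2 ^+ k.
  by move=> r; exact: geometric_limit.
have U1 k r s : `|U d k r - U d k s| <= `|r - s|.
  case: k => [|k]; first by rewrite subrr normr0.
  by have [v [w S]] := step_U d k; exact: step_unit_speed S.
have cu : continuous u.
  move=> s; apply: (@continuous_lipschitz _ u 1) => r; rewrite mul1r.
  apply: (@le_geometric _ _ _ (2 * K r + 2 * K s)) => k; rewrite mulrDl.
  have := Hu r k; have := Hu s k; have := U1 k r s.
  have := ler_normD (u r - U d k r) ((U d k r - U d k s) + (U d k s - u s)).
  have := ler_normD (U d k r - U d k s) (U d k s - u s).
  rewrite (distrC (u r)) (_ : u r - _ + _ = u r - u s); last by ring.
  by lra.
have [u' [v [w S]]] := ex_radial_step d cu.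
suff uu : u = u' by exists u', v, w; move: (S); rewrite uu.
apply/funext => r.
have [r0|r0] := leP r 0.
  rewrite (step_uN S)//; apply/eqP; rewrite -subr_eq0 -normr_le0.
  apply: (@le_geometric _ _ _ (2 * K r)) => k; rewrite add0r.
  by have := Hu r k; rewrite UN// distrC.
apply/eqP; rewrite -subr_eq0 -normr_le0.
apply: (@le_geometric _ _ _ (2 * K r)) => k; rewrite add0r.
have A0 : 0 <= 2 * r / 2 ^+ k by rewrite divr_ge0 ?exprn_ge0// mulr_ge0// ltW.
have [v' [w' S']] := step_U d k.
have close t : 0 <= t <= r -> `|U d k t - u t| <= 2 * r / 2 ^+ k * expR (L * t ^+ 2).
  move=> /andP[t0 tr]; apply: le_trans (Hu t k) _.
  rewrite /K (ger0_norm t0).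
  rewrite (_ : _ / 2 ^+ k = 2 * t / 2 ^+ k * expR (L * t ^+ 2)); last by ring.
  by rewrite ler_wpM2r ?expR_ge0// ler_wpM2r ?invr_ge0 ?exprn_ge0// ler_pM2l.
have := step_contraction L0 gL S' S A0 close; move=> /(_ r); rewrite (ltW r0) lexx => /(_ isT).
have := Hu r k.+1; rewrite subrr normr0 add0r (exprS 2 k) invfM /K (gtr0_norm r0).
set E := expR _; set q := (2 ^+ k)^-1 => h1 h2.
have rq : 0 <= r * q by rewrite mulr_ge0 ?invr_ge0 ?exprn_ge0// ltW.
have -> : u r - u' r = (u r - U d k.+1 r) + (U d k.+1 r - u' r) by ring.
apply: le_trans (ler_normD _ _) _; rewrite (distrC (u r)).
apply: (@le_trans _ _ (2 * (r * E) * (2^-1 * q) + 2 * r * q / 2 * (E - 1))); first exact: lerD.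
rewrite (_ : _ + _ = 2 * (r * E) * q - r * q); last by field.
by rewrite gerBl.
Qed.

End existence.

(** * Uniqueness and polar angle *)

Section uniqueness.
Variables (R : realType) (n : nat) (g : R -> R) (L : R).
Hypothesis L0 : 0 < L.
Hypothesis gL : forall y z, `|g y - g z| <= L * `|y - z|.
Implicit Types (c d r s t : R) (u v w : R -> R).

(* Backward Gronwall inequality on [s, r], away from the singularity at 0. *)
Lemma solution_backward_unique c d u v w r s : radial_solution n g d u v w ->
  g c = 0 -> 0 < s <= r -> u r = c -> w r = 0 -> u s = c.
Proof.
move=> S gc /andP[s0 sr] ur wr.
(* On [[s, r]] one has [|u'| <= |w| / s^n] and [|w'| <= r^n L |u - c|]; [K] is the sum of the two
   rates, so [E * expR (K * t)] is nondecreasing. *)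
pose K := (s ^+ n)^-1 + r ^+ n * L.
pose E t := (u t + - c) ^+ 2 + w t ^+ 2.
pose E' t := 2 * (u t - c) * psi (v t) - 2 * w t * (t ^+ n * g (u t)).
have dE t : is_derive t 1 E (E' t).
  have h1 := is_derive_pow 2 (is_derive_add (step_u S t) (is_derive_const (- c) t)).
  have h := is_derive_add h1 (is_derive_pow 2 (step_w S t)).
  by apply: (is_derive_eq h); rewrite /E' /=; ring.
have dX t : is_derive t 1 (fun t => expR (K * t)) (expR (K * t) * K).
  have h := is_derive_mul (is_derive_const K t) (is_derive_id t (1 : R)).
  have h2 := @is_derive_composite _ expR (fun t => K * t) _ _ _ (is_derive_expR _) h.
  by apply: (is_derive_eq h2); rewrite mul0r add0r mulr1.
have pos t : s < t < r -> 0 <= E' t * expR (K * t) + E t * (expR (K * t) * K).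
  move=> /andP[st tr]; rewrite mulrCA (mulrC (E' t)) -mulrDr mulr_ge0 ?expR_ge0//.
  have t0 : 0 < t by exact: lt_trans st.
  have sn0 : 0 < s ^+ n by rewrite exprn_gt0.
  have pv : `|psi (v t)| <= (s ^+ n)^-1 * `|w t|.
    apply: le_trans (psi_norm_le _) _; rewrite (step_wv S (ltW t0)) normrM.
    rewrite (@ger0_norm _ (t ^+ n)) ?exprn_ge0 ?(ltW t0)// mulrA ler_peMl//.
    by rewrite mulrC ler_pdivlMr// mul1r lerXn2r// ?nnegrE ltW.
  have gv : `|t ^+ n * g (u t)| <= r ^+ n * L * `|u t - c|.
    rewrite normrM ger0_norm ?exprn_ge0 ?(ltW t0)// -mulrA; apply: ler_pM => //.
    - by rewrite exprn_ge0// ltW.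
    - by rewrite lerXn2r// ?nnegrE ltW// (lt_trans t0).
    - by have := gL (u t) c; rewrite gc subr0.
  have h1 : `|(u t - c) * psi (v t)| <= `|u t - c| * ((s ^+ n)^-1 * `|w t|).
    by rewrite normrM ler_wpM2l.
  have h2 : `|w t * (t ^+ n * g (u t))| <= `|w t| * (r ^+ n * L * `|u t - c|).
    by rewrite normrM ler_wpM2l.
  have K0 : 0 <= K.
    by rewrite addr_ge0 ?invr_ge0 ?mulr_ge0 ?exprn_ge0 ?ltW// (lt_trans t0).
  have EE : E t = `|u t - c| ^+ 2 + `|w t| ^+ 2 by rewrite !real_normK ?num_real.
  have am : 0 <= K * (`|u t - c| - `|w t|) ^+ 2 by rewrite mulr_ge0 ?sqr_ge0.
  move: h1 h2 am; rewrite EE /E' !ler_norml /K => /andP[h1 _] /andP[_ h2].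
  set z := `|u t - c|; set y := `|w t|; set q := (s ^+ n)^-1; set p := r ^+ n * L => am.
  rewrite -!mulrA; move: h1 h2; rewrite -/z -/y -/q -/p.
  set a := (u t - c) * _; set b := w t * _ => h1 h2; nra.
have := is_derive_ge0 sr (fun t _ => is_derive_mul (dE t) (dX t)) pos.
rewrite {2}/E ur wr subrr expr0n/= addr0 mul0r pmulr_lle0 ?expR_gt0// /E.
have := sqr_ge0 (u s - c); have := sqr_ge0 (w s) => h1 h2 h3.
by apply/eqP; rewrite -subr_eq0 -sqrf_eq0 eq_le h2 andbT; lra.
Qed.

(** Backward uniqueness would give [u = c] at arbitrarily small positive times, whereas [u] starts
    at [d] and moves at bounded speed. *)
Lemma solution_nonvanishing c d u v w r : radial_solution n g d u v w ->
  g c = 0 -> d != c -> 0 <= r -> u r = c -> w r != 0.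
Proof.
move=> S gc dc r0 ur; apply/negP => /eqP wr.
have [r00|rN0] := eqVneq r 0; first by move: dc; rewrite -ur r00 (step_u0 S) eqxx.
have rp : 0 < r by rewrite lt_neqAle eq_sym rN0.
have e0 : 0 < `|d - c| by rewrite normr_gt0 subr_eq0.
(* Too short a time to travel from [d] to [c] at unit speed. *)
pose s := Num.min r (`|d - c| / 2).
have s0 : 0 < s by rewrite lt_min rp divr_gt0.
have us : u s = c.
  by apply: (solution_backward_unique S gc _ ur wr); rewrite s0 ge_min lexx.
have := step_unit_speed s 0 S; rewrite us (step_u0 S) subr0 distrC (gtr0_norm s0).
have : s <= `|d - c| / 2 by rewrite ge_min lexx orbT.
by lra.
Qed.

End uniqueness.

Section polar_angle.
Variable R : realType.
Implicit Types (z y a b th q : R -> R) (r t : R).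

(* Rotating (z, y) by th, the second coordinate B satisfies B' = (E' / 2E) B for
   E = z^2 + y^2, so that B^2 / E is constant. *)
Lemma polar_angle z y a b th r : 0 <= r ->
  (forall t, 0 <= t <= r -> is_derive t 1 z (a t)) ->
  (forall t, 0 <= t <= r -> is_derive t 1 y (b t)) ->
  (forall t, 0 <= t <= r -> 0 < z t ^+ 2 + y t ^+ 2) ->
  (forall t, 0 <= t <= r ->
     is_derive t 1 th ((y t * a t - z t * b t) / (z t ^+ 2 + y t ^+ 2))) ->
  y 0 = 0 -> th 0 = 0 -> z r * sin (th r) + y r * cos (th r) = 0.
Proof.
move=> r0 dz dy E0 dth y0 th0.
pose E t := z t ^+ 2 + y t ^+ 2.
pose B t := z t * sin (th t) + y t * cos (th t).
have dE t : 0 <= t <= r -> is_derive t 1 E (2 * (z t * a t + y t * b t)).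
  move=> tr; have h := is_derive_add (is_derive_pow 2 (dz t tr)) (is_derive_pow 2 (dy t tr)).
  by apply: (is_derive_eq h); rewrite /=; ring.
have dB t : 0 <= t <= r -> is_derive t 1 B ((z t * a t + y t * b t) / E t * B t).
  move=> tr; have Et : z t ^+ 2 + y t ^+ 2 != 0 by rewrite gt_eqF// E0.
  have hs := is_derive_composite (is_derive_sin (th t)) (dth t tr).
  have hc := is_derive_composite (is_derive_cos (th t)) (dth t tr).
  have h := is_derive_add (is_derive_mul (dz t tr) hs) (is_derive_mul (dy t tr) hc).
  by apply: (is_derive_eq h); rewrite /B /E; field.
have dBE t : 0 <= t <= r -> is_derive t 1 (fun t => B t ^+ 2 * (E t)^-1) 0.
  move=> tr; have Et : E t != 0 by rewrite gt_eqF// E0.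
  have h := is_derive_mul (is_derive_pow 2 (dB t tr)) (is_derive_inv (dE t tr) Et).
  by apply: (is_derive_eq h); rewrite /=; field.
have := is_derive_eq0 r0 dBE; rewrite {1}/B y0 th0 sin0 mulr0 mul0r addr0 expr0n mul0r.
have Er : (E r == 0) = false by rewrite gt_eqF// E0// r0 lexx.
move=> /esym/eqP; rewrite mulf_eq0 invr_eq0 Er orbF sqrf_eq0.
by move/eqP.
Qed.

Lemma cos_eq0_ge0 r : 0 <= r -> cos r = 0 -> exists m, r = pi / 2 + m%:R * pi.
Proof.
move=> r0 cr; have pi0 := pi_gt0 R.
exists (Num.truncn (r / pi)); set m := Num.truncn _.
have /andP[m1 m2] : m%:R <= r / pi < m.+1%:R.
  by apply: truncn_itv; rewrite divr_ge0// ltW.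
move: m1 m2; rewrite ler_pdivlMr// ltr_pdivrMr// => m1 m2.
have cE k : cos (r - k%:R * pi) = 0.
  elim: k => [|k IH]; first by rewrite mul0r subr0.
  rewrite -(@natr1 _ k) mulrDl mul1r opprD addrA; set x := r - _ in IH *.
  by rewrite cosB IH sinpi; ring.
have := cE m; rewrite -cos_pihalf => /cos_inj; rewrite !in_itv/=.
rewrite -(@natr1 _ m) mulrDl mul1r in m2.
move=> h; suff : r - m%:R * pi = pi / 2 by lra.
by apply: h; apply/andP; split; lra.
Qed.

Lemma cos_pihalfDn m : cos (pi / 2 + m%:R * pi) = 0 :> R.
Proof.
elim: m => [|m IH]; first by rewrite mul0r addr0 cos_pihalf.
have -> : m.+1%:R * pi = m%:R * pi + pi :> R by rewrite -(@natr1 _ m); ring.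
by rewrite addrA cosD IH sinpi; ring.
Qed.

Lemma sin_natpi m : sin (m%:R * pi) = 0 :> R.
Proof.
elim: m => [|m IH]; first by rewrite mul0r sin0.
by rewrite -(@natr1 _ m) mulrDl mul1r sinD IH sinpi; ring.
Qed.

(** Monotonicity alone would allow [th] to rest at a level [pi / 2 + m * pi]; the positive speed
    there makes each crossing unique. The levels below [j * pi] are those with [m < j]. *)
Lemma card_angle_crossings th q r j : 0 < r ->
  (forall t, 0 <= t <= r -> is_derive t 1 th (q t)) ->
  (forall t, 0 <= t <= r -> 0 <= q t) ->
  (forall t, 0 < t < r -> cos (th t) = 0 -> 0 < q t) ->
  th 0 = 0 -> th r = j%:R * pi ->
  [set t | 0 < t < r /\ cos (th t) = 0] #= `I_j.
Proof.
move=> r0 dth q0 qp th0 thr; have pi0 := pi_gt0 R.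
have mono s t : 0 <= s -> s <= t -> t <= r -> th s <= th t.
  move=> s0 st tr; apply: (is_derive_ge0 (f := q)) => // x /andP[sx xt].
    by apply: dth; apply/andP; split; [exact: le_trans sx|exact: le_trans tr].
  by apply: q0; apply/andP; split; [exact: le_trans (ltW sx)|exact: le_trans (ltW xt) tr].
have uniq s t : 0 < s < r -> 0 < t < r -> cos (th s) = 0 -> th s = th t -> s = t.
  wlog st : s t / s <= t.
    move=> H; have [/H//|/ltW/H{}H] := leP s t.
    by move=> s1 t1 cs E; apply/esym/H => //; rewrite -E.
  move=> /andP[s1 s2] /andP[t1 t2] cs E; apply/eqP; move: st; rewrite le_eqVlt => /predU1P[->//|st].
  (* The speed vanishes at some [c] between [s] and [t], where monotonicity pins [th c] to the same
     zero of [cos]. *)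
  have [|c /andP[sc ct]] := @MVT_is_derive _ th q s t st.
    by move=> x /andP[sx xt]; apply: dth; apply/andP; split; lra.
  rewrite E subrr => /esym/eqP; rewrite mulf_eq0 subr_eq0 (gt_eqF st) orbF => /eqP qc.
  have : 0 < q c.
    apply: qp; first by apply/andP; split; lra.
    have sc' : th s <= th c by apply: mono; lra.
    have ct' : th c <= th t by apply: mono; lra.
    by rewrite -cs; congr cos; apply/eqP; rewrite eq_le sc' andbT -E in ct' *.
  by rewrite qc ltxx.
have ex m : exists t, (m < j)%N -> 0 < t < r /\ th t = pi / 2 + m%:R * pi.
  have [mj|mj] := ltnP m j; last by exists 0.
  have mjR : m%:R + 1 <= j%:R :> R by rewrite natr1 ler_nat.
  have m0 : 0 <= m%:R :> R by rewrite ler0n.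
  have m1 : 0 < pi / 2 + m%:R * pi :> R by nra.
  have m2 : pi / 2 + m%:R * pi < j%:R * pi :> R by nra.
  have [||c] := @IVT _ th 0 r (pi / 2 + m%:R * pi) (ltW r0).
  - by apply: (is_derive_within (g := q)).
  - by rewrite th0 thr ge_min le_max (ltW m1) (ltW m2) orbT.
  rewrite in_itv/= => /andP[c0 cr] E; exists c => _; split => //.
  rewrite !lt_neqAle c0 cr !andbT; apply/andP; split; apply/negP => /eqP e.
    by move: m1; rewrite -E -e th0 ltxx.
  by move: m2; rewrite -E e thr ltxx.
have [tau Htau] := choice ex.
have -> : [set t | 0 < t < r /\ cos (th t) = 0] = tau @` `I_j.
  apply/seteqP; split => [t [/andP[t0 tr] ct]|t [m /= mj <-]]; last first.
    by have [h1 h2] := Htau m mj; split => //; rewrite h2 cos_pihalfDn.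
  have tht0 : 0 <= th t by rewrite -th0 mono// ltW.
  have [m Em] := cos_eq0_ge0 tht0 ct.
  have mj : (m < j)%N.
    have := mono t r (ltW t0) (ltW tr) (lexx _); rewrite Em thr -(ltr_nat R).
    by rewrite -(ltr_pM2r pi0); lra.
  have [h1 h2] := Htau m mj; exists m => //.
  by apply: uniq => //; rewrite ?h2 ?cos_pihalfDn ?t0.
have := @inj_card_eq _ _ `I_j tau; apply => m1 m2.
rewrite !inE => /= h1 h2 E; have [_ e1] := Htau _ h1; have [_ e2] := Htau _ h2.
apply/eqP; rewrite -(eqr_nat R); apply/eqP/(mulIf (lt0r_neq0 pi0)).
by move: e1 e2; rewrite E => ->; lra.
Qed.

End polar_angle.

(** * Families of functions locally Lipschitz in a parameter *)

Section locally_lipschitz_family.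
Variables (R : realType) (rho d : R).
Implicit Types (F G : R -> R -> R) (h : R -> R).

(** The comparison is with the base parameter [d] only, uniformly in time; the bound [B] is included
    so that products stay in the class. *)
Definition lipschitz_family F := exists eta K B : R, 0 < eta /\
  forall d' t, `|d' - d| <= eta -> 0 <= t <= rho ->
    `|F d' t - F d t| <= K * `|d' - d| /\ `|F d' t| <= B.

Lemma lipschitz_family_indep h B : (forall t, 0 <= t <= rho -> `|h t| <= B) ->
  lipschitz_family (fun _ => h).
Proof.
move=> hB; exists 1, 0, B; split => // d' t _ tr; split; last exact: hB.
by rewrite subrr normr0 mul0r.
Qed.

Lemma lipschitz_family_add F G : lipschitz_family F -> lipschitz_family G ->
  lipschitz_family (fun d' t => F d' t + G d' t).
Proof.
move=> [e1 [K1 [B1 [e10 H1]]]] [e2 [K2 [B2 [e20 H2]]]].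
exists (Num.min e1 e2), (K1 + K2), (B1 + B2); split; first by rewrite lt_min e10.
move=> d' t; rewrite le_min => /andP[/H1 h1 /H2 h2] tr.
have [h11 h12] := h1 _ tr; have [h21 h22] := h2 _ tr; split.
  rewrite opprD addrACA mulrDl; exact: le_trans (ler_normD _ _) (lerD _ _).
exact: le_trans (ler_normD _ _) (lerD _ _).
Qed.

Lemma lipschitz_family_mul F G : lipschitz_family F -> lipschitz_family G ->
  lipschitz_family (fun d' t => F d' t * G d' t).
Proof.
move=> [e1 [K1 [B1 [e10 H1]]]] [e2 [K2 [B2 [e20 H2]]]].
exists (Num.min e1 e2), (K1 * B2 + B1 * K2), (B1 * B2); split; first by rewrite lt_min e10.
move=> d' t; rewrite le_min => /andP[dd1 dd2] tr.
have [h11 h12] := H1 _ _ dd1 tr; have [h21 h22] := H2 _ _ dd2 tr.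
have d0 e : 0 < e -> `|d - d| <= e by move=> e0; rewrite subrr normr0 ltW.
have [_ h12'] := H1 _ _ (d0 _ e10) tr.
split; last by rewrite normrM; apply: ler_pM.
have -> : F d' t * G d' t - F d t * G d t =
  (F d' t - F d t) * G d' t + F d t * (G d' t - G d t) by ring.
apply: le_trans (ler_normD _ _) _; rewrite !normrM mulrDl mulrAC -(mulrA B1).
by apply: lerD; apply: ler_pM.
Qed.

Lemma lipschitz_family_inv F e : 0 < e -> (forall t, 0 <= t <= rho -> e <= F d t) ->
  lipschitz_family F -> lipschitz_family (fun d' t => (F d' t)^-1).
Proof.
move=> e0 Fe [e1 [K [B [e10 H]]]].
have K0 : 0 < `|K| + 1 by rewrite ltr_wpDl.
(* Within this radius [F d' t] differs from [F d t] by at most [e / 2], hence stays above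
   [e / 2]. *)
exists (Num.min e1 (e / 2 / (`|K| + 1))), (K * (2 / e) * (e^-1)), (2 / e); split.
  by rewrite lt_min e10 !divr_gt0.
move=> d' t; rewrite le_min => /andP[dd1]; rewrite ler_pdivlMr// => dd2 tr.
have [h1 _] := H _ _ dd1 tr; have h2 := Fe _ tr.
have h3 : `|F d' t - F d t| <= e / 2.
  apply: le_trans h1 _; apply: le_trans dd2; rewrite mulrC ler_wpM2l//.
  by have := ler_norm K; lra.
have h4 : e / 2 <= F d' t by move: h3; rewrite ler_norml => /andP[]; lra.
have F0 : 0 < F d t by apply: lt_le_trans h2.
have F0' : 0 < F d' t by apply: lt_le_trans h4; rewrite divr_gt0.
have i1 : (F d' t)^-1 <= 2 / e by rewrite -[2 / e]invrK lef_pV2 ?posrE ?invr_gt0 ?divr_gt0// invf_div.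
have i2 : (F d t)^-1 <= e^-1 by rewrite lef_pV2.
have i10 : 0 <= (F d' t)^-1 by rewrite invr_ge0 ltW.
have i20 : 0 <= (F d t)^-1 by rewrite invr_ge0 ltW.
split; last by rewrite ger0_norm.
have -> : (F d' t)^-1 - (F d t)^-1 = - ((F d' t - F d t) * ((F d' t)^-1 * (F d t)^-1)).
  by field; rewrite !gt_eqF.
rewrite normrN normrM (ger0_norm (mulr_ge0 i10 i20)).
rewrite (_ : K * _ * _ * _ = K * `|d' - d| * (2 / e * e^-1)); last by ring.
by apply: ler_pM; rewrite ?mulr_ge0//; apply: ler_pM.
Qed.

Lemma lipschitz_family_comp F h K : (forall y z, `|h y - h z| <= K * `|y - z|) ->
  0 <= K -> lipschitz_family F -> lipschitz_family (fun d' t => h (F d' t)).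
Proof.
move=> hK K0 [e1 [K1 [B1 [e10 H1]]]]; exists e1, (K * K1), (K * B1 + `|h 0|); split => // d' t dd tr.
have [h1 h2] := H1 _ _ dd tr; split.
  by apply: le_trans (hK _ _) _; rewrite -mulrA ler_wpM2l.
have := ler_normD (h (F d' t) - h 0) (h 0); rewrite subrK => h3.
apply: le_trans h3 _; rewrite lerD2r; apply: le_trans (hK _ _) _.
by rewrite subr0 ler_wpM2l.
Qed.

Lemma lipschitz_family_uniform F K : 0 <= rho ->
  (forall d' t, 0 <= t <= rho -> `|F d' t - F d t| <= K * `|d' - d|) ->
  continuous (F d) -> lipschitz_family F.
Proof.
move=> r0 FK cF.
have cN : {within `[0, rho], continuous (fun t => `|F d t|)}.
  by apply: continuous_subspaceT => t; apply: continuous_comp; [exact: cF|exact: norm_continuous].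
have [c _ Hc] := EVT_max r0 cN.
exists 1, K, (`|K| + `|F d c|); split => // d' t dd tr; split; first exact: FK.
have h1 := Hc t tr; have := ler_normD (F d' t - F d t) (F d t); rewrite subrK => h2.
apply: le_trans h2 _; apply: lerD => //; apply: le_trans (FK _ _ tr) _.
apply: (@le_trans _ _ (`|K| * `|d' - d|)); first by rewrite ler_wpM2r// ler_norm.
by rewrite ler_piMr.
Qed.

End locally_lipschitz_family.

Section angle.
Variables (R : realType) (n : nat) (g : R -> R) (L lam : R).
Hypothesis L0 : 0 < L.
Hypothesis gL : forall y z, `|g y - g z| <= L * `|y - z|.
Hypothesis g1 : g 1 = 0.
Hypothesis gsgn : forall y, 0 <= g y * (y - 1).
Hypothesis lam0 : 0 < lam.
Implicit Types (d r t rho : R) (u v w : R -> R).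

Definition angle_num u v w r :=
  lam * (r ^+ n * g (u r)) * (u r - 1) + lam * w r * psi (v r).

Definition angle_den u w r := (u r - 1) ^+ 2 + (lam * w r) ^+ 2.

(* Angular speed, around the equilibrium (1, 0), of (u, - lam * w). *)
Definition angle_rate u v w r := angle_num u v w r * (angle_den u w r)^-1.

(** Its polar meaning is recovered in [angle_polar]. Negative [r] are sent to 0 because the
    denominator of the speed is controlled for [r >= 0]. *)
Definition angle u v w := primitive (fun r => angle_rate u v w (Num.max r 0)).

Section one_solution.
Variables (d : R) (u v w : R -> R).
Hypothesis S : radial_solution n g d u v w.
Hypothesis d1 : d != 1.

Lemma angle_den_gt0 r : 0 <= r -> 0 < angle_den u w r.
Proof.
move=> r0; rewrite lt_neqAle eq_sym addr_ge0 ?sqr_ge0// andbT.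
apply/negP => /eqP E; have := sqr_ge0 (u r - 1); have := sqr_ge0 (lam * w r) => h1 h2.
have /eqP : (u r - 1) ^+ 2 = 0 by rewrite /angle_den in E; lra.
have /eqP : (lam * w r) ^+ 2 = 0 by rewrite /angle_den in E; lra.
rewrite !sqrf_eq0 subr_eq0 mulf_eq0 gt_eqF//= => w0 /eqP u1.
by move: (solution_nonvanishing L0 gL S g1 d1 r0 u1); rewrite w0.
Qed.

Let cu : continuous u. Proof. exact: step_continuous S. Qed.
Let cv : continuous v. Proof. exact: step_v S. Qed.
Let cw : continuous w.
Proof. by move=> r; exact: is_derive_continuous (step_w S r). Qed.

Lemma continuous_angle_den : continuous (angle_den u w).
Proof.
apply: continuous_add; apply: continuous_pow.
  by apply: continuous_add => //; exact: continuous_const.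
by apply: continuous_mul => //; exact: continuous_const.
Qed.

Let continuous_rate : continuous (fun r => angle_rate u v w (Num.max r 0)).
Proof.
have cg : continuous g by move=> y; apply: continuous_lipschitz => z; exact: gL.
have cmax : continuous (fun r : R => Num.max r 0).
  by move=> r; apply: continuous_max; [exact: cvg_id|exact: cvg_cst].
have cnum : continuous (angle_num u v w).
  apply: continuous_add.
    apply: continuous_mul; last by apply: continuous_add => //; exact: continuous_const.
    apply: continuous_mul; first exact: continuous_const.
    apply: continuous_mul; last exact: continuous_composite.
    by apply: continuous_pow => r; exact: cvg_id.
  apply: continuous_mul; first by apply: continuous_mul => //; exact: continuous_const.
  by apply: continuous_composite => //; exact: continuous_psi.
apply: continuous_mul; first exact: (continuous_composite cnum cmax).
move=> r; apply: (@continuousV _ _ (fun r => angle_den u w (Num.max r 0))); last first.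
  exact: (continuous_composite continuous_angle_den cmax).
by rewrite gt_eqF// angle_den_gt0// le_max lexx orbT.
Qed.

Lemma angle0 : angle u v w 0 = 0.
Proof. exact: primitive0. Qed.

Lemma is_derive_angle r : 0 <= r -> is_derive r 1 (angle u v w) (angle_rate u v w r).
Proof.
move=> r0; have := is_derive_primitive r continuous_rate.
by rewrite (max_l r0).
Qed.

Lemma angle_rate_ge0 r : 0 <= r -> 0 <= angle_rate u v w r.
Proof.
move=> r0; rewrite mulr_ge0 ?invr_ge0 ?(ltW (angle_den_gt0 r0))// addr_ge0//.
  by rewrite -!mulrA mulr_ge0 ?(ltW lam0)// mulr_ge0 ?exprn_ge0.
rewrite (step_wv S r0) -!mulrA mulr_ge0 ?(ltW lam0)// mulr_ge0 ?exprn_ge0//.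
exact: mul_psi_ge0.
Qed.

Lemma angle_le r t : 0 <= r -> r <= t -> angle u v w r <= angle u v w t.
Proof.
move=> r0 rt; apply: (is_derive_ge0 (f := angle_rate u v w)) => // x /andP[rx _].
  by apply: is_derive_angle; exact: le_trans rx.
by apply: angle_rate_ge0; rewrite (le_trans r0)// ltW.
Qed.

Lemma angle_polar r : 0 <= r ->
  (u r - 1) * sin (angle u v w r) + lam * w r * cos (angle u v w r) = 0.
Proof.
move=> r0.
have du t : 0 <= t <= r -> is_derive t 1 (fun t => u t - 1) (psi (v t)).
  by move=> _; have := is_derive_add (step_u S t) (is_derive_const (-1) t); rewrite addr0.
have dw t : 0 <= t <= r -> is_derive t 1 (fun t => lam * w t) (lam * - (t ^+ n * g (u t))).
  move=> _; have := is_derive_mul (is_derive_const lam t) (step_w S t).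
  by rewrite mul0r add0r.
apply: (polar_angle r0 du dw).
- by move=> t /andP[t0 _]; exact: angle_den_gt0.
- move=> t /andP[t0 _]; apply: (is_derive_eq (is_derive_angle t0)).
  by rewrite /angle_rate /angle_num /angle_den; ring.
- by rewrite (step_w0 S) mulr0.
- exact: angle0.
Qed.

(** By [angle_polar], [cos = 0] forces [u = 1]; conversely [u = 1] excludes [w = 0] and so forces
    [cos = 0]. The value of [lam] does not matter here. *)
Lemma angle_cos_eq0 r : 0 <= r -> (cos (angle u v w r) == 0) = (u r == 1).
Proof.
move=> r0; have h := angle_polar r0; have cs := cos2Dsin2 (angle u v w r).
apply/eqP/eqP => [c0|u1].
  move: h cs; rewrite c0 mulr0 addr0 expr0n add0r => /eqP.
  rewrite mulf_eq0 => /orP[|/eqP ->]; first by rewrite subr_eq0 => /eqP.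
  by rewrite expr0n/= => /eqP; rewrite eq_sym oner_eq0.
move: h; rewrite u1 subrr mul0r add0r => /eqP; rewrite mulf_eq0 => /orP[|/eqP//].
by rewrite mulf_eq0 gt_eqF//= (negbTE (solution_nonvanishing L0 gL S g1 d1 r0 u1)).
Qed.

Lemma angle_sin_eq0 r : 0 <= r -> sin (angle u v w r) = 0 -> w r = 0.
Proof.
move=> r0 s0; have h := angle_polar r0; have cs := cos2Dsin2 (angle u v w r).
move: h cs; rewrite s0 mulr0 add0r expr0n addr0 => /eqP.
rewrite mulf_eq0 => /orP[|/eqP ->]; last first.
  by rewrite expr0n/= => /eqP; rewrite eq_sym oner_eq0.
by rewrite mulf_eq0 gt_eqF//= => /eqP.
Qed.

(** At a zero of [u - 1] the torque term disappears and [lam * w * psi v] remains, with [v != 0] by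
    [solution_nonvanishing]. *)
Lemma angle_rate_gt0 r : 0 < r -> u r = 1 -> 0 < angle_rate u v w r.
Proof.
move=> r0 u1; rewrite mulr_gt0 ?invr_gt0 ?angle_den_gt0 ?ltW//.
rewrite /angle_num u1 subrr mulr0 add0r (step_wv S (ltW r0)) -!mulrA.
have := solution_nonvanishing L0 gL S g1 d1 (ltW r0) u1.
rewrite (step_wv S (ltW r0)) mulf_eq0 negb_or => /andP[_ v0].
by rewrite mulr_gt0// mulr_gt0 ?exprn_gt0// mul_psi_gt0.
Qed.

(** Reaching [pi / 2] would produce a zero of [cos], that is a point where [u = 1]. *)
Lemma angle_lt_pihalf r : 0 <= r -> (forall t, 0 <= t <= r -> u t != 1) ->
  angle u v w r < pi / 2.
Proof.
move=> r0 u1; rewrite ltNge; apply/negP => H; have p0 := pi_gt0 R.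
have [||c] := @IVT _ (angle u v w) 0 r (pi / 2) r0.
- apply: (is_derive_within (g := angle_rate u v w)) => t /andP[t0 _].
  exact: is_derive_angle.
- by rewrite angle0 ge_min le_max H orbT andbT; apply/orP; left; lra.
rewrite in_itv/= => cr E; have := u1 _ cr; case/andP: cr => c0 _.
by rewrite -(angle_cos_eq0 c0) E cos_pihalf eqxx.
Qed.

Lemma angle_zeros rho j : 0 < rho -> angle u v w rho = j%:R * pi ->
  [set r | 0 < r < rho /\ u r - 1 = 0] #= `I_j /\ v rho = 0.
Proof.
move=> r0 E; split; last first.
  have := angle_sin_eq0 (ltW r0); rewrite E sin_natpi => /(_ erefl).
  rewrite (step_wv S (ltW r0)) => /eqP; rewrite mulf_eq0 expf_eq0 gt_eqF// andbF/=.
  by move/eqP.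
have -> : [set r | 0 < r < rho /\ u r - 1 = 0] =
          [set t | 0 < t < rho /\ cos (angle u v w t) = 0].
  apply/seteqP; split => t [/andP[t0 tr]] => /eqP.
    by rewrite subr_eq0 -(angle_cos_eq0 (ltW t0)) => /eqP ?; split=> //; rewrite t0.
  by rewrite angle_cos_eq0 ?(ltW t0)// -subr_eq0 => /eqP ?; split=> //; rewrite t0.
apply: (@card_angle_crossings _ _ (angle_rate u v w)) => //.
- by move=> t /andP[t0 _]; exact: is_derive_angle.
- by move=> t /andP[t0 _]; exact: angle_rate_ge0.
- move=> t /andP[t0 _] /eqP; rewrite angle_cos_eq0 ?(ltW t0)// => /eqP.
  exact: angle_rate_gt0.
- exact: angle0.
Qed.

End one_solution.

Variables u v w : R -> R -> R.
Hypothesis S : forall d, radial_solution n g d (u d) (v d) (w d).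

Lemma solution_v_dependence d d' r : 0 <= r ->
  `|v d r - v d' r| <= L * (2 * expR (L * r ^+ 2)) * r * `|d - d'|.
Proof.
move=> r0; rewrite mulrAC; apply: (step_v_dist (S d) (S d') r0) => t /andP[t0 tr].
apply: le_trans (gL _ _) _; rewrite -mulrA ler_pM2l// mulrAC.
apply: le_trans (solution_dependence L0 gL (S d) (S d') t0) _.
by rewrite ler_wpM2l ?mulr_ge0// ler_expR ler_pM2l// lerXn2r ?nnegrE// (le_trans t0).
Qed.

(** The angular speeds for [d'] and [d] differ by at most a multiple of [|d' - d|], uniformly on
    [[0, rho]]. Inverting the denominator uses its positive minimum on that compact interval for the
    base value [d]. *)
Lemma continuous_angle rho d : 0 <= rho -> d != 1 ->
  {for d, continuous (fun d => angle (u d) (v d) (w d) rho)}.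
Proof.
move=> r0 d1.
have lc (c : R) : lipschitz_family rho d (fun _ _ => c).
  by apply: (@lipschitz_family_indep _ _ _ _ `|c|).
have e_le t : 0 <= t <= rho -> expR (L * t ^+ 2) <= expR (L * rho ^+ 2).
  by move=> /andP[t0 tr]; rewrite ler_expR ler_pM2l// lerXn2r ?nnegrE.
have lu : lipschitz_family rho d u.
  apply: (@lipschitz_family_uniform _ _ _ u (2 * expR (L * rho ^+ 2))) => //.
    move=> d' t tr; have /andP[t0 _] := tr.
    apply: le_trans (solution_dependence L0 gL (S d') (S d) t0) _.
    by rewrite mulrAC ler_wpM2r// ler_wpM2l// e_le.
  exact: step_continuous (S d).
pose K := L * (2 * expR (L * rho ^+ 2)) * rho.
have lvK d' t : 0 <= t <= rho -> `|v d' t - v d t| <= K * `|d' - d|.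
  move=> tr; have /andP[t0 tr'] := tr.
  apply: le_trans (solution_v_dependence d' d t0) _; rewrite ler_wpM2r//.
  apply: ler_pM => //; first by rewrite !mulr_ge0 ?expR_ge0// ltW.
  by rewrite ler_pM2l// ler_wpM2l// e_le.
have lv : lipschitz_family rho d v.
  by apply: (@lipschitz_family_uniform _ _ _ v K) => //; exact: step_v (S d).
have lw : lipschitz_family rho d w.
  apply: (@lipschitz_family_uniform _ _ _ w (rho ^+ n * K)) => //.
    move=> d' t tr; have /andP[t0 tr'] := tr.
    rewrite (step_wv (S d') t0) (step_wv (S d) t0) -mulrBr normrM normrX ger0_norm// -mulrA.
    by apply: ler_pM; rewrite ?exprn_ge0 ?lerXn2r ?nnegrE ?lvK.
  by move=> t; exact: is_derive_continuous (step_w (S d) t).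
have lp : lipschitz_family rho d (fun _ t => t ^+ n).
  apply: (@lipschitz_family_indep _ _ _ _ (rho ^+ n)) => t /andP[t0 tr].
  by rewrite ger0_norm ?exprn_ge0// lerXn2r ?nnegrE.
have lu1 : lipschitz_family rho d (fun d' t => u d' t - 1) by exact: lipschitz_family_add.
have lw1 : lipschitz_family rho d (fun d' t => lam * w d' t) by exact: lipschitz_family_mul.
have lnum : lipschitz_family rho d (fun d' => angle_num (u d') (v d') (w d')).
  apply: lipschitz_family_add; apply: lipschitz_family_mul => //.
    apply: lipschitz_family_mul => //; apply: lipschitz_family_mul => //.
    by apply: (lipschitz_family_comp gL) => //; exact: ltW.
  apply: (@lipschitz_family_comp _ _ _ _ (@psi R) 1) => // y z.
  by rewrite mul1r; exact: psi_lipschitz.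
have lden : lipschitz_family rho d (fun d' => angle_den (u d') (w d')).
  by apply: lipschitz_family_add; apply: lipschitz_family_mul.
have [c c0 Hc] := EVT_min r0 (continuous_subspaceT (@continuous_angle_den d _ _ _ (S d))).
have E0 : 0 < angle_den (u d) (w d) c.
  by apply: (angle_den_gt0 (S d) d1); rewrite in_itv/= in c0; case/andP: c0.
have [eta [Kr [B [eta0 H]]]] := lipschitz_family_mul lnum (lipschitz_family_inv E0 Hc lden).
have Kr0 : 0 <= `|Kr| by [].
apply/cvgrPdist_le => e e0.
have near1 : \forall d' \near d, `|d - d'| < Num.min eta (e / (`|Kr| * rho + 1)).
  by apply: nbhsx_ballx; rewrite lt_min eta0 divr_gt0// ltr_wpDl// mulr_ge0.
have near2 : \forall d' \near d, d' != 1.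
  have : 0 < `|d - 1| by rewrite normr_gt0 subr_eq0.
  move=> dd; have : \forall d' \near d, `|d - d'| < `|d - 1| by apply: nbhsx_ballx.
  by apply: filterS => d' h; apply/eqP => d'1; move: h; rewrite d'1 ltxx.
apply: filterS2 near1 near2 => d'; rewrite lt_min => /andP[h1 h2] d'1.
rewrite ltr_pdivlMr ?ltr_wpDl ?mulr_ge0// in h2.
have dth t : 0 <= t <= rho -> is_derive t 1
   (fun t => angle (u d) (v d) (w d) t + - angle (u d') (v d') (w d') t)
   (angle_rate (u d) (v d) (w d) t + - angle_rate (u d') (v d') (w d') t).
  move=> /andP[t0 _]; apply: is_derive_add; first exact: (is_derive_angle (S d)).
  by apply: is_derive_opp; exact: (is_derive_angle (S d')).
have dG t : 0 <= t <= rho -> is_derive t 1 (fun t => `|Kr| * `|d - d'| * t) (`|Kr| * `|d - d'|).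
  move=> _; have := is_derive_mul (is_derive_const (`|Kr| * `|d - d'|) t) (is_derive_id t (1:R)).
  by rewrite mul0r add0r mulr1.
have bd t : 0 < t < rho ->
   `|angle_rate (u d) (v d) (w d) t + - angle_rate (u d') (v d') (w d') t| <= `|Kr| * `|d - d'|.
  move=> /andP[t0 tr]; have [||h _] := H d' t; first by rewrite distrC ltW.
    by rewrite !ltW.
  rewrite distrC; apply: le_trans h _; rewrite (distrC d) ler_wpM2r//; exact: ler_norm.
have := is_derive_norm_le r0 dth dG bd.
rewrite (angle0 (S d) d1) (angle0 (S d') d'1) subrr !subr0 mulr0 subr0 => h; apply: le_trans h _.
have dd0 := normr_ge0 (d - d'); rewrite mulrAC mulrC.
by apply: le_trans (ltW h2); rewrite ler_wpM2l//; lra.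
Qed.

End angle.

(** * Small angles and rotation *)

Section extreme_data.
Variables (R : realType) (n : nat) (g : R -> R) (L : R).
Hypothesis L0 : 0 < L.
Hypothesis gL : forall y z, `|g y - g z| <= L * `|y - z|.
Implicit Types (c d r t rho : R) (u v w : R -> R).

Lemma constant_solution c : g c = 0 ->
  radial_solution n g c (fun=> c) (fun=> 0) (fun=> 0).
Proof.
move=> gc; split => //.
- by move=> r; rewrite psi0; exact: is_derive_const.
- by move=> r; rewrite gc mulr0 oppr0; exact: is_derive_const.
- by move=> r _; rewrite mulr0.
- exact: continuous_const.
Qed.

Lemma solution_near_constant c d u v w rho t : g c = 0 -> radial_solution n g d u v w ->
  0 <= t <= rho -> `|u t - c| <= 2 * expR (L * rho ^+ 2) * `|d - c|.
Proof.
move=> gc S /andP[t0 tr].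
apply: le_trans (solution_dependence L0 gL S (constant_solution gc) t0) _.
by rewrite mulrAC ler_wpM2r// ler_wpM2l// ler_expR ler_pM2l// lerXn2r ?nnegrE// (le_trans t0).
Qed.

(** Comparison with the constant solution 0. *)
Lemma solution_lt1_of_small rho : g 0 = 0 -> exists2 eta, 0 < eta & forall d u v w t,
  radial_solution n g d u v w -> 0 < d < eta -> 0 <= t <= rho -> u t != 1.
Proof.
move=> g0; set K := 2 * expR (L * rho ^+ 2); have K0 : 0 < K by rewrite mulr_gt0 ?expR_gt0.
exists K^-1; first by rewrite invr_gt0.
move=> d u v w t S /andP[d0 dK] tr; apply/eqP => u1.
have := solution_near_constant g0 S tr; rewrite u1 !subr0 normr1 (gtr0_norm d0) -/K.
by move: dK; rewrite -[K^-1]mul1r ltr_pdivlMr// mulrC => h; rewrite leNgt h.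
Qed.

(** The distance of [u] to 1 is of order [|d - 1|] on [[0, rho]], so [g (u t)] is of smaller order
    and [u] moves by less than [|d - 1|]. *)
Lemma solution_neq1_of_near1 rho : 0 <= rho -> g 1 = 0 ->
  (forall e, 0 < e -> exists2 del, 0 < del &
     forall y, `|y - 1| <= del -> `|g y| <= e * `|y - 1|) ->
  exists2 eta, 0 < eta & forall d u v w t,
  radial_solution n g d u v w -> 0 < `|d - 1| < eta -> 0 <= t <= rho -> u t != 1.
Proof.
move=> r0 g1 gsmall; set K := 2 * expR (L * rho ^+ 2).
have K0 : 0 < K by rewrite mulr_gt0 ?expR_gt0.
have q0 : 0 < K * rho ^+ 2 + 1 by rewrite ltr_wpDl// mulr_ge0 ?sqr_ge0// ltW.
(* With this slope the displacement is at most [K * rho ^+ 2 / (K * rho ^+ 2 + 1)] times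
   [|d - 1|]. *)
have [|del del0 gdel] := gsmall (K * rho ^+ 2 + 1)^-1; first by rewrite invr_gt0.
exists (del / K); first by rewrite divr_gt0.
move=> d u v w t S /andP[d0 dK] tr; move: dK; rewrite ltr_pdivlMr// mulrC => dK.
have close s : 0 <= s <= rho -> `|u s - 1| <= K * `|d - 1|.
  by move=> sr; exact: (solution_near_constant g1 S sr).
pose B := (K * rho ^+ 2 + 1)^-1 * (K * `|d - 1|).
have gB s : 0 <= s <= rho -> `|g (u s)| <= B.
  move=> sr; apply: le_trans (gdel _ _) _.
    by apply: le_trans (close _ sr) _; rewrite ltW.
  by rewrite ler_wpM2l ?close// invr_ge0 ltW.
have B0 : 0 <= B by apply: le_trans (gB 0 _); rewrite ?lexx.
have vB s : 0 <= s <= rho -> `|v s| <= B * rho.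
  move=> /andP[s0 sr]; rewrite -[v s]subr0.
  apply: (@le_trans _ _ (B * s)); last by rewrite ler_wpM2l.
  apply: (step_v_dist S (constant_solution g1)) => // y /andP[y0 ys].
  by rewrite g1 subr0 gB// y0 (le_trans ys).
have /andP[t0 trho] := tr.
have du s : 0 <= s <= t -> is_derive s 1 u (psi (v s)) by move=> _; exact: step_u S s.
have dG s : 0 <= s <= t -> is_derive s 1 (fun s => B * rho * s) (B * rho).
  move=> _; have := is_derive_mul (is_derive_const (B * rho) s) (is_derive_id s (1:R)).
  by rewrite mul0r add0r mulr1.
have := is_derive_norm_le t0 du dG; rewrite (step_u0 S) mulr0 subr0 => h.
apply/eqP => u1; move: h; rewrite u1 => h.
have : `|1 - d| <= B * rho * t.
  apply: h => s /andP[s0 st]; apply: le_trans (psi_norm_le _) _; apply: vB.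
  by rewrite ltW//= (le_trans (ltW st)).
apply/negP; rewrite -ltNge; apply: (@le_lt_trans _ _ (B * rho * rho)).
  by rewrite ler_wpM2l// mulr_ge0.
rewrite (distrC 1) /B (_ : _ * rho * rho = `|d - 1| * (K * rho ^+ 2) / (K * rho ^+ 2 + 1)); last by ring.
by rewrite ltr_pdivrMr// ltr_pM2l// ltrDl.
Qed.

Lemma solution_gt1_of_large rho d u v w t : radial_solution n g d u v w ->
  rho + 2 <= d -> 0 <= t <= rho -> u t != 1.
Proof.
move=> S dr /andP[t0 tr]; have := step_unit_speed t 0 S.
rewrite (step_u0 S) subr0 (ger0_norm t0) ler_norml => /andP[h _].
by rewrite gt_eqF//; lra.
Qed.

(** The form of the equation with explicit friction [n v / t], on which the energy estimate
    rests. *)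
Lemma is_derive_v d u v w t : radial_solution n g d u v w -> 0 < t ->
  is_derive t 1 v (- g (u t) - n%:R * v t / t).
Proof.
move=> S t0; have tn0 : t != 0 by rewrite gt_eqF.
apply: (@near_eq_is_derive _ _ _ (fun t => w t * (t ^+ n)^-1)).
  apply: filterS (lt_nbhsr t0) => y y0.
  by rewrite (step_wv S (ltW y0)) mulrC mulKf// expf_neq0// gt_eqF.
have tnn0 : t ^+ n != 0 by rewrite expf_neq0.
have h := is_derive_mul (step_w S t) (is_derive_inv (is_derive_pow n (is_derive_id t (1 : R))) tnn0).
apply: (is_derive_eq h); rewrite (step_wv S (ltW t0)) /=.
(* The derivative of [t ^+ n] contains [n.-1], so the case [n = 0] is separate. *)
case: n tnn0 => [|m] tnn0; first by rewrite /= expr0; field.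
by rewrite /= exprS; field; rewrite tn0 expf_neq0.
Qed.

End extreme_data.

(** * Energy and speed of rotation around the equilibrium *)

Section rotation.
Variables (R : realType) (G F : R -> R).
Implicit Types (y z v h e : R).
Hypothesis cG : continuous G.
Hypothesis dF : forall y, is_derive y 1 F (G y).
Hypothesis F1 : F 1 = 0.
Hypothesis GN : forall y, y <= 0 -> G y = 0.
Hypothesis Gneg : forall y, 0 < y < 1 -> G y < 0.
Hypothesis Gpos : forall y, 1 < y -> 0 < G y.

(** [F] decreases strictly from 0 to its zero at 1 and increases strictly afterwards; for negative
    arguments it is constant, equal to [F 0]. *)
Lemma potential_gt0 y : y != 1 -> 0 < F y.
Proof.
have F0 : 0 < F 0.
  have [c c01] := MVT_is_derive ltr01 (fun x _ => dF x).
  by rewrite F1 sub0r subr0 mulr1; have := Gneg c01; lra.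
move=> y1; have [y0|y0] := leP y 0.
  rewrite (_ : F y = F 0)//; apply: (is_derive_eq0 y0) => z /andP[_ z0].
  by rewrite -(GN z0); exact: dF.
have [y2|y2] := ltP y 1.
  have [c /andP[c0 c1]] := MVT_is_derive y2 (fun x _ => dF x).
  have : G c < 0 by apply: Gneg; rewrite c1 andbT (lt_trans y0).
  by rewrite F1 sub0r => h1 h2; nra.
have {}y2 : 1 < y by rewrite lt_neqAle eq_sym y1.
have [c /andP[c0 c1]] := MVT_is_derive y2 (fun x _ => dF x).
by have := Gpos c0; rewrite F1 subr0 => h1 h2; nra.
Qed.

Lemma potential_ge0 y : 0 <= F y.
Proof. by have [->|/potential_gt0/ltW//] := eqVneq y 1; rewrite F1. Qed.

Lemma potential_le y z : 1 <= y -> y <= z -> F y <= F z.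
Proof.
move=> y1 yz; apply: (is_derive_ge0 yz (fun x _ => dF x)) => x /andP[yx _].
by rewrite ltW// Gpos// (le_lt_trans y1).
Qed.

(** Levels below both barriers [F 0] and [F 2] are confined to a bounded well; 2 stands for an
    arbitrary point to the right of 1. *)
Lemma potential_well y h : h < F 0 -> h < F 2 -> F y <= h -> 0 < y < 2.
Proof.
move=> h0 h2 Fh; apply/andP; split; rewrite ltNge; apply/negP => yy.
  have : F y = F 0; last by lra.
  by apply: is_derive_eq0 => // x /andP[_ x0]; rewrite -(GN x0); exact: dF.
have h12 : (1 : R) <= 2 by lra.
by have := potential_le h12 yy; lra.
Qed.

Lemma torque_ge0 y : 0 <= G y * (y - 1).
Proof.
have [/GN ->|y0] := leP y 0; first by rewrite mul0r.
have [y1|y1|->] := ltgtP y 1; last by rewrite subrr mulr0.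
- by have : G y < 0 by [apply: Gneg; rewrite y0]; nra.
- by have := Gpos y1; nra.
Qed.

(** Either the kinetic energy is at least [h / 4], which bounds [v * psi v] below, or
    [F y >= h / 4], and compactness bounds the torque below. The factor 4 anticipates the square of
    the rescaled weight, which is at most 2. *)
Lemma rotation_speed h : 0 < h -> h < F 0 -> h < F 2 ->
  exists2 omega, 0 < omega & forall y v,
    h / 2 <= Num.sqrt (1 + v ^+ 2) - 1 + F y <= h ->
    omega * ((y - 1) ^+ 2 + 4 * v ^+ 2) <= G y * (y - 1) + v * psi v.
Proof.
move=> h0 hF0 hF2.
(* The penalties are positive exactly where [F] leaves [[h / 4, h]]; thus [p] is positive on all of
   [[0, 2]] and equals the torque where it is needed. *)
pose p y := G y * (y - 1) + (Num.max 0 (h / 4 - F y) + Num.max 0 (F y - h)).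
have cF : continuous F by move=> y; exact: is_derive_continuous (dF y).
have cmax (f : R -> R) : continuous f -> continuous (fun y => Num.max 0 (f y)).
  by move=> cf y; apply: continuous_max; [exact: cvg_cst|exact: cf].
have cid : continuous (fun y : R => y) by move=> y; exact: cvg_id.
have cp : continuous p.
  apply: continuous_add.
    by apply: continuous_mul => //; apply: continuous_add => //; exact: continuous_const.
  by apply: continuous_add; apply: cmax; apply: continuous_add => //;
    [exact: continuous_const|exact: continuous_opp|exact: continuous_const].
have [c c02 Hc] := EVT_min (ler0n R 2) (continuous_subspaceT cp).
have pc0 : 0 < p c.
  have m0 (x : R) : 0 <= Num.max 0 x by rewrite le_max lexx.
  have t0 := torque_ge0 c.
  have [Fh|Fh] := ltP (F c) (h / 4).
    have : 0 < Num.max 0 (h / 4 - F c) by rewrite lt_max subr_gt0 Fh orbT.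
    by have := m0 (F c - h); rewrite /p; lra.
  have [Fh'|Fh'] := ltP h (F c).
    have : 0 < Num.max 0 (F c - h) by rewrite lt_max subr_gt0 Fh' orbT.
    by have := m0 (h / 4 - F c); rewrite /p; lra.
  have /andP[cc0 cc2] := potential_well hF0 hF2 Fh'.
  have c1 : c != 1 by apply/eqP => c1; move: Fh; rewrite c1 F1; lra.
  have : 0 < G c * (c - 1).
    have [c1'|c1'|/eqP] := ltgtP c 1; last by rewrite (negbTE c1).
    - by have : G c < 0 by [apply: Gneg; rewrite cc0]; nra.
    - by have := Gpos c1'; nra.
  by have := m0 (h / 4 - F c); have := m0 (F c - h); rewrite /p; lra.
pose m := Num.min (h / 4) (p c).
have m0 : 0 < m by rewrite lt_min pc0 divr_gt0.
(* Energy at most [h] forces [|y - 1| < 1] and [v ^+ 2 <= (1 + h) ^+ 2]. *)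
pose K := 1 + 4 * (1 + h) ^+ 2.
have K0 : 0 < K by rewrite addr_gt0// mulr_gt0// exprn_gt0// addr_gt0.
exists (m / K); first by rewrite divr_gt0.
move=> y v /andP[H1 H2].
have s1 := sqrt1D_ge1 v; have s2 := sqrt1D_sq v; have mp := mul_psi v.
have ps := mul_psi_ge0 v; have tq := torque_ge0 y; have Fy := potential_ge0 y.
move: H1 H2 s1 s2 mp; set s := Num.sqrt _ => H1 H2 s1 s2 mp.
have Fyh : F y <= h by lra.
have /andP[y0 y2] := potential_well hF0 hF2 Fyh.
have den : (y - 1) ^+ 2 + 4 * v ^+ 2 <= K by rewrite /K; nra.
apply: (@le_trans _ _ m).
  by rewrite mulrAC ler_pdivrMr// ler_pM2l.
have [Fh|Fh] := ltP (F y) (h / 4).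
  have sI : s^-1 <= 1 by rewrite invf_le1//; lra.
  by apply: (@le_trans _ _ (h / 4)); [rewrite /m ge_min lexx|lra].
have := Hc y; rewrite in_itv/= (ltW y0) (ltW y2) => /(_ isT); rewrite {2}/p.
rewrite (max_l (_ : h / 4 - F y <= 0)) ?subr_le0// (max_l (_ : F y - h <= 0)) ?subr_le0//.
rewrite !addr0 => hp.
have : m <= p c by rewrite /m ge_min lexx orbT.
by lra.
Qed.

Lemma mul_psi_le_energy y v h : Num.sqrt (1 + v ^+ 2) - 1 + F y <= h ->
  v * psi v <= 1 + h.
Proof.
move=> H; have := mul_psi v; have := potential_ge0 y; have := sqrt1D_gt0 v.
move=> s0 Fy ->; have : 0 < (Num.sqrt (1 + v ^+ 2))^-1 by rewrite invr_gt0.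
by lra.
Qed.

Variables (n : nat) (h omega T r0 : R).
Hypotheses (h0 : 0 < h) (omega0 : 0 < omega).
Hypothesis speed : forall y v, h / 2 <= Num.sqrt (1 + v ^+ 2) - 1 + F y <= h ->
    omega * ((y - 1) ^+ 2 + 4 * v ^+ 2) <= G y * (y - 1) + v * psi v.
(** [r0T] keeps the weight within a factor 2 on [[r0, r0 + T]]; [r0h] keeps the energy loss there
    below [h / 2]. *)
Hypotheses (T0 : 0 < T) (r00 : 0 < r0) (r0T : 2 * n%:R * T <= r0)
  (r0h : 2 * n%:R * T * (1 + h) <= h * r0).

(** [(1 + T / r0)^n <= exp (n T / r0) <= exp (1 / 2) <= 2]. *)
Lemma weight_ratio t : r0 <= t <= r0 + T -> r0 ^+ n <= t ^+ n <= 2 * r0 ^+ n.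
Proof.
move=> /andP[t1 t2]; have t0 : 0 < t by exact: lt_le_trans t1.
rewrite lerXn2r ?nnegrE ?(ltW r00) ?(ltW t0)//=.
have tr : t <= r0 * expR (T / r0).
  apply: le_trans t2 _; rewrite -{1}(mulr1 r0).
  rewrite (_ : r0 * 1 + T = r0 * (1 + T / r0)); last by field; rewrite gt_eqF.
  by rewrite ler_pM2l// expR_ge1Dx.
apply: (@le_trans _ _ ((r0 * expR (T / r0)) ^+ n)).
  by rewrite lerXn2r ?nnegrE ?mulr_ge0 ?expR_ge0 ?(ltW t0) ?(ltW r00).
rewrite exprMn mulrC ler_wpM2r ?exprn_ge0 ?(ltW r00)// -expRM_natl.
have nT : n%:R * (T / r0) <= 2^-1.
  by rewrite mulrA ler_pdivrMr//; move: r0T; rewrite -mulrA; set nt := _ * T; lra.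
apply: (@le_trans _ _ (expR 2^-1)); first by rewrite ler_expR.
(* [exp (- 1 / 2) >= 1 / 2], which inverts to the required bound. *)
have := expR_ge1Dx (- 2^-1 : R); rewrite expRN => e.
rewrite -lef_pV2 ?posrE ?expR_gt0//.
by move: e; set q := (expR _)^-1; lra.
Qed.

Variables (g : R -> R) (L : R) (d : R) (u v w : R -> R).
Hypothesis L0 : 0 < L.
Hypothesis gL : forall y z, `|g y - g z| <= L * `|y - z|.
Hypothesis S : radial_solution n g d u v w.
Hypothesis gG : forall t, r0 <= t <= r0 + T -> g (u t) = G (u t).
Hypothesis d1 : d != 1.
Hypothesis gsgn : forall y, 0 <= g y * (y - 1).
Hypothesis g1 : g 1 = 0.

Let H t := Num.sqrt (1 + v t ^+ 2) - 1 + F (u t).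
Hypothesis Hr0 : H r0 = h.

(** The energy decreases at rate [n v psi(v) / t], which is at most [n (1 + h) / r0]; over a time
    [T] the loss is at most [h / 2]. *)
Lemma energy_window t : r0 <= t <= r0 + T -> h / 2 <= H t <= h.
Proof.
have dH s : r0 <= s <= r0 + T -> is_derive s 1 H (- (n%:R * (v s * psi (v s)) / s)).
  move=> sr; have s0 : 0 < s by case/andP: sr => + _; exact: lt_le_trans.
  have h1 := @is_derive_composite _ (fun y => Num.sqrt (1 + y ^+ 2)) v _ _ _
    (is_derive_sqrt1D (v s)) (is_derive_v S s0).
  have h2 := is_derive_composite (dF (u s)) (step_u S s).
  have h3 := is_derive_add (is_derive_add h1 (is_derive_const (-1) s)) h2.
  by apply: (is_derive_eq h3); rewrite (gG sr) /=; field; rewrite gt_eqF.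
(* The upper bound comes before the lower one because it controls the dissipation. *)
have up t' : r0 <= t' <= r0 + T -> H t' <= h.
  move=> /andP[t1 t2].
  have dN s : r0 <= s <= t' -> is_derive s 1 (fun s => - H s) (n%:R * (v s * psi (v s)) / s).
    move=> /andP[s1 s2]; rewrite -[X in is_derive _ _ _ X]opprK; apply: is_derive_opp.
    by apply: dH; rewrite s1 (le_trans s2).
  have := is_derive_ge0 t1 dN; rewrite Hr0 => hh.
  suff : - h <= - H t' by lra.
  apply: hh => s /andP[s1 s2]; apply: divr_ge0; first by rewrite mulr_ge0 ?mul_psi_ge0.
  by rewrite ltW// (lt_trans r00).
move=> /andP[t1 t2]; rewrite up ?t1// andbT.
have dHt s : r0 <= s <= t -> is_derive s 1 H (- (n%:R * (v s * psi (v s)) / s)).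
  by move=> /andP[s1 s2]; apply: dH; rewrite s1 (le_trans s2).
pose c := n%:R * (1 + h) / r0.
have dc s : r0 <= s <= t -> is_derive s 1 (fun s => - c * s) (- c).
  move=> _; have := is_derive_mul (is_derive_const (- c) s) (is_derive_id s (1:R)).
  by rewrite mul0r add0r mulr1.
have hp : 0 <= 1 + h by move: h0; lra.
have c0 : 0 <= c by rewrite divr_ge0 ?(ltW r00)// mulr_ge0.
have := is_derive_le t1 dc dHt; rewrite Hr0 => hh.
have : - c * t - - c * r0 <= H t - h.
  apply: hh => s /andP[s1 s2]; have s0 : 0 < s by exact: lt_trans s1.
  have e1 : v s * psi (v s) <= 1 + h.
    by apply: (@mul_psi_le_energy (u s)); apply: up; rewrite ltW//=; lra.
  rewrite lerN2 /c; apply: ler_pM.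
  - by rewrite mulr_ge0 ?mul_psi_ge0.
  - by rewrite invr_ge0 ltW.
  - by rewrite ler_wpM2l.
  - by rewrite lef_pV2 ?posrE// ltW.
have : c * T <= h / 2.
  rewrite /c mulrAC ler_pdivrMr//; move: r0h.
  rewrite (_ : 2 * n%:R * T * (1 + h) = 2 * (n%:R * (1 + h) * T)); last by ring.
  by set x := _ * T; lra.
have : c * (t - r0) <= c * T by rewrite ler_wpM2l//; lra.
by lra.
Qed.

(** With [lam = (r0 ^+ n)^-1] the factor [mu = lam * t ^+ n] lies in [[1, 2]]: the numerator of the
    angular speed is at least the autonomous one and the denominator is at most [(u - 1)^2 + 4 v^2].
    The angle gained before [r0] is nonnegative and is discarded. *)
Lemma angle_after_rotation :
  omega * T <= angle n g (r0 ^+ n)^-1 u v w (r0 + T).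
Proof.
have l0 : 0 < (r0 ^+ n)^-1 by rewrite invr_gt0 exprn_gt0.
have dth t : r0 <= t <= r0 + T -> is_derive t 1 (angle n g (r0 ^+ n)^-1 u v w)
    (angle_rate n g (r0 ^+ n)^-1 u v w t).
  by move=> /andP[t1 _]; apply: (is_derive_angle L0 gL g1 l0 S d1); rewrite (le_trans (ltW r00)).
have dw t : r0 <= t <= r0 + T -> is_derive t 1 (fun t => omega * t) omega.
  move=> _; have := is_derive_mul (is_derive_const omega t) (is_derive_id t (1:R)).
  by rewrite mul0r add0r mulr1.
have rT : r0 <= r0 + T by rewrite lerDl ltW.
have hle := is_derive_le rT dw dth.
have th0 : 0 <= angle n g (r0 ^+ n)^-1 u v w r0.
  rewrite -(angle0 L0 gL g1 l0 S d1).
  by apply: (angle_le L0 gL g1 gsgn l0 S d1) => //; exact: ltW.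
suff : omega * (r0 + T) - omega * r0 <= angle n g (r0 ^+ n)^-1 u v w (r0 + T) - angle n g (r0 ^+ n)^-1 u v w r0.
  by lra.
apply: hle => t /andP[t1 t2].
have tt : r0 <= t <= r0 + T by rewrite !ltW.
have t0 : 0 < t by exact: lt_trans t1.
rewrite /angle_rate ler_pdivlMr; last exact: (angle_den_gt0 L0 gL g1 l0 S d1 (ltW t0)).
have := speed (energy_window tt).
have /andP[mu1 mu2] := weight_ratio tt.
rewrite /angle_num /angle_den (step_wv S (ltW t0)) (gG tt).
have p0 : 0 < r0 ^+ n by rewrite exprn_gt0.
have : 1 <= (r0 ^+ n)^-1 * t ^+ n by rewrite mulrC ler_pdivlMr// mul1r.
have : (r0 ^+ n)^-1 * t ^+ n <= 2 by rewrite mulrC ler_pdivrMr.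
set q := (r0 ^+ n)^-1; set mu := q * t ^+ n => m2 m1 sp.
have tq := torque_ge0 (u t); have ps := mul_psi_ge0 (v t).
have -> : q * (t ^+ n * G (u t)) * (u t - 1) + q * (t ^+ n * v t) * psi (v t) =
  mu * (G (u t) * (u t - 1) + v t * psi (v t)) by rewrite /mu; ring.
rewrite (mulrA q) -/mu.
apply: (@le_trans _ _ (G (u t) * (u t - 1) + v t * psi (v t))); last first.
  by rewrite ler_peMl// addr_ge0.
apply: le_trans sp; rewrite ler_pM2l// exprMn lerD2l ler_wpM2r ?sqr_ge0//.
by nra.
Qed.

End rotation.

(** * C1 functions on the closed half-line *)

Section C1_half_line.
Variables (R : realType) (f f' : R -> R).
Hypothesis df : has_deriv_on `[0, +oo[ f f'.
Hypothesis cf' : {within `[0, +oo[, continuous f'}.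
Implicit Types (x y z M e : R).

Lemma has_deriv_on_dist x e : 0 <= x -> 0 < e -> exists2 del, 0 < del &
  forall y, 0 <= y -> `|y - x| < del -> `|f y - f x - f' x * (y - x)| <= e * `|y - x|.
Proof.
move=> x0 e0; have Dx : `[0, +oo[%classic x by rewrite /= in_itv/= andbT.
have /cvgrPdist_le /(_ e e0) := df Dx.
move=> [del/= del0 H]; exists del => // y y0 yx.
have [->|yN] := eqVneq y x; first by rewrite !subrr mulr0 subrr normr0 mulr0.
have := H y; rewrite /= distrC => /(_ yx yN).
rewrite in_itv/= y0 => /(_ isT).
have yx0 : y - x != 0 by rewrite subr_eq0.
have -> : f y - f x - f' x * (y - x) = - (f' x - (f y - f x) / (y - x)) * (y - x) by field.
by rewrite normrM normrN => h; rewrite ler_wpM2r.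
Qed.

Lemma is_derive_of_has_deriv_on x : 0 < x -> is_derive x 1 f (f' x).
Proof.
move=> x0.
have cvg : (fun h => h^-1 *: (f (h *: 1 + x) - f x)) @ 0^' --> f' x.
  apply/cvgrPdist_le => e e0; have [del del0 H] := has_deriv_on_dist (ltW x0) e0.
  exists (Num.min del x) => /=; first by rewrite lt_min del0.
  move=> h/=; rewrite sub0r normrN lt_min => /andP[h1 h2] hN.
  have hx : 0 <= h + x by move: h2; rewrite ltr_norml => /andP[]; lra.
  have := H (h + x) hx; rewrite addrK => /(_ h1) hh.
  rewrite /GRing.scale/= mulr1 distrC.
  have -> : h^-1 * (f (h + x) - f x) - f' x = (f (h + x) - f x - f' x * h) / h by field.
  by rewrite normrM normfV ler_pdivrMr// normr_gt0.
apply: DeriveDef; last by apply/cvg_lim.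
by apply/cvg_ex; exists (f' x).
Qed.

(** The mean value theorem applies away from 0; the end point 0, where the derivative is one-sided,
    is reached by a limit. *)
Lemma C1_lipschitz M : 0 < M -> exists2 L, 0 < L &
  forall y z, 0 <= y <= M -> 0 <= z <= M -> `|f y - f z| <= L * `|y - z|.
Proof.
move=> M0.
have cM : {within `[0, M], continuous f'}.
  apply: continuous_subspaceW cf' => x /=; rewrite !in_itv/= => /andP[-> _]//.
have [c1 _ H1] := EVT_max (ltW M0) cM; have [c2 _ H2] := EVT_min (ltW M0) cM.
pose L := `|f' c1| + `|f' c2| + 1.
have L0 : 0 < L by rewrite ltr_wpDl// addr_ge0.
have bd x : 0 <= x <= M -> `|f' x| <= L.
  move=> xM; have := H1 x xM; have := H2 x xM; rewrite /L.
  have := ler_norm (f' c1); have := ler_norm (- f' c2); rewrite normrN => h1 h2 h3 h4.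
  have := normr_ge0 (f' c1); have := normr_ge0 (f' c2).
  by rewrite ler_norml; lra.
have pos y z : 0 < y -> y < z -> z <= M -> `|f z - f y| <= L * (z - y).
  move=> y0 yz zM.
  have [x /andP[x1 x2] ->] := MVT_is_derive yz (fun x xyz => is_derive_of_has_deriv_on (lt_le_trans y0 (proj1 (andP xyz)))).
  rewrite normrM (gtr0_norm (_ : 0 < z - y)) ?subr_gt0// ler_wpM2r ?subr_ge0 ?(ltW yz)//.
  by apply: bd; rewrite (ltW (lt_trans y0 x1)) (le_trans (ltW x2)).
have all y z : 0 <= y -> y < z -> z <= M -> `|f z - f y| <= L * (z - y).
  rewrite le_eqVlt => /predU1P[<-|]; last exact: pos.
  move=> z0 zM; rewrite subr0; apply/ler_addgt0Pl => e e0.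
  have [del del0 H] := has_deriv_on_dist (lexx 0) (ltr01 : (0 : R) < 1).
  pose K := `|f' 0| + 1; have K0 : 0 < K by rewrite ltr_wpDl.
  (* [s] lies in the range of the expansion at 0, stays below [z], and makes the increment over
     [[0, s]] at most [e]. *)
  pose s := Num.min (del / 2) (Num.min (z / 2) (e / K)).
  have s0 : 0 < s by rewrite !lt_min !divr_gt0.
  have s1 : s <= del / 2 by rewrite ge_min lexx.
  have s2 : s <= z / 2 by rewrite !ge_min lexx orbT.
  have s3 : s <= e / K by rewrite !ge_min lexx !orbT.
  have /(_ (ltW s0)) := H s; rewrite !subr0 (gtr0_norm s0) mul1r => h1.
  have {}h1 : `|f s - f 0 - f' 0 * s| <= s by apply: h1; lra.
  have h2 : `|f z - f s| <= L * (z - s) by apply: pos => //; lra.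
  have h3 : L * (z - s) <= L * z by rewrite ler_pM2l// gerBl ltW.
  have h4 : `|f' 0 * s| <= `|f' 0| * s by rewrite normrM (gtr0_norm s0).
  have h5 : K * s <= e by rewrite mulrC -ler_pdivlMr.
  have := ler_normD (f z - f s) ((f s - f 0 - f' 0 * s) + f' 0 * s).
  have := ler_normD (f s - f 0 - f' 0 * s) (f' 0 * s).
  rewrite subrK (_ : f z - f s + _ = f z - f 0); last by ring.
  by rewrite /K in h5; lra.
exists L => // y z /andP[y0 yM] /andP[z0 zM].
have [yz|yz|->] := ltgtP y z; last by rewrite !subrr normr0 mulr0.
  rewrite distrC (distrC y) (gtr0_norm (_ : 0 < z - y)) ?subr_gt0//; exact: all.
rewrite (gtr0_norm (_ : 0 < y - z)) ?subr_gt0//; exact: all.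
Qed.

(** At an interior point the derivative along the half-line is the usual one, so [f] has a vanishing
    first order expansion there. Capping the radius by [x] keeps [y] in the half-line. *)
Lemma C1_small_near x : 0 < x -> f x = 0 -> derive1 f x = 0 ->
  forall e, 0 < e -> exists2 del, 0 < del &
    forall y, `|y - x| <= del -> `|f y| <= e * `|y - x|.
Proof.
move=> x0 fx f'x e e0; have dx := is_derive_of_has_deriv_on x0.
have {}f'x : f' x = 0 by rewrite -f'x derive1E derive_val.
have [del del0 H] := has_deriv_on_dist (ltW x0) e0.
exists (Num.min (del / 2) x); first by rewrite lt_min divr_gt0.
move=> y; rewrite le_min => /andP[y1 y2].
have := H y; rewrite f'x mul0r fx !subr0; apply; last by lra.
by move: y2; rewrite ler_norml => /andP[]; lra.
Qed.

End C1_half_line.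

(** * Truncation of the nonlinearity *)

Section truncation.
Variables (R : realType) (f : R -> R).
Implicit Types (y z M : R).

Lemma max_lipschitz (a y z : R) : `|Num.max y a - Num.max z a| <= `|y - z|.
Proof.
rewrite ler_norml; have := ler_norm (y - z); have := ler_norm (z - y); rewrite (distrC z).
by case: (leP y a); case: (leP z a); lra.
Qed.

Lemma min_lipschitz (a y z : R) : `|Num.min y a - Num.min z a| <= `|y - z|.
Proof.
rewrite ler_norml; have := ler_norm (y - z); have := ler_norm (z - y); rewrite (distrC z).
by case: (leP y a); case: (leP z a); lra.
Qed.

(** The assumptions on [f] concern nonnegative arguments only; the constant [f 0] replaces its
    values elsewhere. *)
Definition extend0 y := f (Num.max y 0).

(** Capping at [M] makes the Lipschitz bound on [[0, M]] global and the nonlinearity bounded, as the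
    Picard iteration requires. *)
Definition truncate M y := extend0 (Num.min y M).

Lemma truncate_lipschitz M L : 0 < M -> 0 <= L ->
  (forall y z, 0 <= y <= M -> 0 <= z <= M -> `|f y - f z| <= L * `|y - z|) ->
  forall y z, `|truncate M y - truncate M z| <= L * `|y - z|.
Proof.
move=> M0 L0 fL y z; rewrite /truncate /extend0; apply: le_trans (fL _ _ _ _) _.
- by rewrite le_max lexx orbT ge_max ge_min lexx orbT ltW.
- by rewrite le_max lexx orbT ge_max ge_min lexx orbT ltW.
- by rewrite ler_wpM2l//; apply: le_trans (max_lipschitz _ _ _) (min_lipschitz _ _ _).
Qed.

Lemma truncate_bounded M L : 0 < M -> 0 <= L ->
  (forall y z, 0 <= y <= M -> 0 <= z <= M -> `|f y - f z| <= L * `|y - z|) ->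
  forall y, `|truncate M y| <= L * M + `|f 0|.
Proof.
move=> M0 L0 fL y; have := ler_normD (truncate M y - f 0) (f 0); rewrite subrK => h.
apply: le_trans h _; rewrite lerD2r /truncate /extend0.
have mM : 0 <= Num.max (Num.min y M) 0 <= M.
  by rewrite le_max lexx orbT ge_max ge_min lexx orbT ltW.
apply: le_trans (fL _ _ mM _) _; first by rewrite lexx ltW.
by case/andP: mM => m0 mM; rewrite subr0 ler_wpM2l// ger0_norm.
Qed.

Lemma truncateE M y : y <= M -> truncate M y = extend0 y.
Proof. by move=> yM; rewrite /truncate min_l. Qed.

Lemma continuous_extend0 : (forall M, 0 < M -> exists2 L, 0 < L &
    forall y z, 0 <= y <= M -> 0 <= z <= M -> `|f y - f z| <= L * `|y - z|) ->
  continuous extend0.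
Proof.
move=> fL y; pose M := `|y| + 1; have M0 : 0 < M by rewrite ltr_wpDl.
have [L L0 H] := fL M M0.
apply: (@near_eq_continuous _ _ (truncate M)).
  have : y < M by rewrite /M; have := ler_norm y; lra.
  by move/lt_nbhsl; apply: filterS => z zM; rewrite truncateE// ltW.
by apply: (@continuous_lipschitz _ _ L) => z; apply: truncate_lipschitz => //; exact: ltW.
Qed.

End truncation.

(** * Shooting *)

(** Number of zeros prescribed for [u_j]; the indices [j] and [2k + 1 - j] share it. *)
Definition fold_index k j := if (j <= k)%N then j else (2 * k + 1 - j)%N.

Lemma fold_index_bounds k j : (1 <= j <= 2 * k)%N -> (1 <= fold_index k j <= k)%N.
Proof. by rewrite /fold_index; case: ifP; lia. Qed.

Lemma fold_index_inj k i j : (1 <= i <= 2 * k)%N -> (1 <= j <= 2 * k)%N ->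
  (i <= k)%N = (j <= k)%N -> fold_index k i = fold_index k j -> i = j.
Proof. by rewrite /fold_index => ik jk ->; case: ifP; lia. Qed.

Lemma fold_index_reflect k j : (1 <= j <= k)%N ->
  (1 <= 2 * k + 1 - j <= 2 * k)%N /\ fold_index k (2 * k + 1 - j) = j.
Proof. by rewrite /fold_index => jk; split; [|case: ifP]; lia. Qed.

(* The range of initial values u(0) in which the shooting argument looks for u_j^{+-}. *)
Definition shooting_range (R : realType) (dm dp top : R) k (s : bool) j (d : R) :=
  if s then (if (j <= k)%N then 1 < d < dp else dp < d < top)
  else (if (j <= k)%N then dm < d < 1 else 0 < d < dm).

Lemma shooting_range_inj (R : realType) (dm dp top : R) k s t i j d :
  0 < dm < 1 -> 1 < dp < top ->
  shooting_range dm dp top k s i d -> shooting_range dm dp top k t j d ->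
  s = t /\ (i <= k)%N = (j <= k)%N.
Proof.
rewrite /shooting_range => /andP[h1 h2] /andP[h3 h4].
by case: s t => -[]; case: (i <= k)%N; case: (j <= k)%N => // /andP[a1 a2] /andP[a3 a4];
  exfalso; lra.
Qed.

Lemma shooting_range_bounds (R : realType) (dm dp top d : R) k s j :
  0 < dm < 1 -> 1 < dp < top -> shooting_range dm dp top k s j d ->
  [/\ 0 < d, d <= top & if s then 1 < d else d < 1].
Proof.
rewrite /shooting_range => /andP[h1 h2] /andP[h3 h4].
by case: s; case: (j <= k)%N => /andP[a1 a2]; split; lra.
Qed.

Lemma ivt_between (R : realType) (th : R -> R) (a b c : R) : a <= b -> (forall x, a <= x <= b -> {for x, continuous th}) ->
  (th a < c < th b) || (th b < c < th a) -> exists2 x, a < x < b & th x = c.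
Proof.
move=> ab cth h.
have cw : {within `[a, b], continuous th}.
  apply/subspace_continuousP => x /=; rewrite in_itv/= => xab.
  apply: cvg_within_filter; exact: cth.
have [||x] := @IVT _ th a b c ab => //.
  by rewrite ge_min le_max; case/orP: h => /andP[/ltW -> /ltW ->]; rewrite ?orbT.
rewrite in_itv/= => /andP[ax xb] E; exists x => //.
rewrite !lt_neqAle ax xb !andbT; apply/andP; split; apply/eqP => e.
  by move: h; rewrite -E -e !ltxx andbF.
by move: h; rewrite -E e !ltxx andbF.
Qed.

(** Every range has an end with angle above [k * pi] and an end with angle below [pi / 2]. Near 0
    and 1 the small angle holds only in a punctured or one-sided neighbourhood, so the range is
    first shortened at that end. *)
Lemma shooting_ranges_hit (R : realType) (th : R -> R) (dm dp top eta0 eta1 : R) k :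
  (forall d, d != 1 -> {for d, continuous th}) -> 0 < dm < 1 -> 1 < dp < top ->
  k%:R * pi < th dm -> k%:R * pi < th dp -> 0 < eta0 -> 0 < eta1 ->
  (forall d, d != 1 -> 0 < d < eta0 -> th d < pi / 2) ->
  (forall d, 0 < `|d - 1| < eta1 -> th d < pi / 2) -> th top < pi / 2 ->
  forall s j, (1 <= j <= 2 * k)%N ->
  exists d, th d = (fold_index k j)%:R * pi /\ shooting_range dm dp top k s j d.
Proof.
move=> cth /andP[dm0 dm1] /andP[dp1 dptop] thm thp eta00 eta10 small0 small1 smalltop s j jk.
have pi0 := pi_gt0 R.
have hit a b i : (1 <= i <= k)%N -> a <= b -> (b < 1) || (1 < a) ->
  (th a < pi / 2 /\ k%:R * pi < th b) \/ (th b < pi / 2 /\ k%:R * pi < th a) ->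
  exists2 x, a < x < b & th x = i%:R * pi.
  move=> /andP[i1 ik] ab ab1 hab; apply: ivt_between => //.
    move=> x /andP[ax xb]; apply: cth; case/orP: ab1 => h1.
      by rewrite lt_eqF// (le_lt_trans xb).
    by rewrite gt_eqF// (lt_le_trans h1).
  have ipi1 : pi <= i%:R * pi :> R by rewrite ler_peMl ?(ltW pi0)// ler1n.
  have ipi2 : i%:R * pi <= k%:R * pi :> R by rewrite ler_pM2r// ler_nat.
  have pi2 : pi / 2 < pi :> R by rewrite ltr_pdivrMr// ltr_pMr// ltr1n.
  case: hab => [[h1 h2]|[h1 h2]]; apply/orP; [left|right];
    by rewrite (lt_le_trans h1 (le_trans (ltW pi2) ipi1)) (le_lt_trans ipi2 h2).
have ik := fold_index_bounds jk.
case: s; rewrite /shooting_range; case: (j <= k)%N.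
- pose e := Num.min (dp - 1) eta1 / 2; pose a := 1 + e.
  have e0 : 0 < e by rewrite divr_gt0// lt_min eta10 subr_gt0 dp1.
  have [e1 e2] : e < dp - 1 /\ e < eta1.
    have := subr_gt0 1 dp; rewrite dp1 /e => dp0.
    by split; rewrite ltr_pdivrMr// gt_min; apply/orP; [left|right]; lra.
  have [|||x /andP[x1 x2] Ex] := hit a dp (fold_index k j) ik.
  + by rewrite /a; lra.
  + by apply/orP; right; rewrite /a; lra.
  + by left; split => //; apply: small1; rewrite /a addrC addKr gtr0_norm ?e0.
  by exists x; split => //; rewrite x2 andbT; move: x1; rewrite /a; lra.
- have [|||x x12 Ex] := hit dp top (fold_index k j) ik; last by exists x.
  + exact: ltW.
  + by apply/orP; right.
  + by right.
- pose e := Num.min (1 - dm) eta1 / 2; pose b := 1 - e.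
  have e0 : 0 < e by rewrite divr_gt0// lt_min eta10 subr_gt0 dm1.
  have [e1 e2] : e < 1 - dm /\ e < eta1.
    have := subr_gt0 dm 1; rewrite dm1 /e => dp0.
    by split; rewrite ltr_pdivrMr// gt_min; apply/orP; [left|right]; lra.
  have [|||x /andP[x1 x2] Ex] := hit dm b (fold_index k j) ik.
  + by rewrite /b; lra.
  + by apply/orP; left; rewrite /b; lra.
  + right; split => //; apply: small1.
    by rewrite /b (_ : 1 - e - 1 = - e) ?normrN ?gtr0_norm ?e0//; ring.
  by exists x; split => //; rewrite x1/=; move: x2; rewrite /b; lra.
- pose a := Num.min dm eta0 / 2.
  have a0 : 0 < a by rewrite divr_gt0// lt_min eta00 dm0.
  have [a1 a2] : a < dm /\ a < eta0.
    by rewrite /a; split; rewrite ltr_pdivrMr// gt_min; apply/orP; [left|right]; lra.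
  have [|||x /andP[x1 x2] Ex] := hit a dm (fold_index k j) ik.
  + exact: ltW.
  + by apply/orP; left.
  + left; split => //; apply: small0; last by rewrite a0.
    by rewrite lt_eqF// (lt_trans a1).
  by exists x; split => //; rewrite x2 andbT (lt_trans a0).
Qed.

Section shooting.
Variables (R : realType) (n : nat) (f : R -> R).
Hypothesis hfC1 : C1_on `[0, +oo[ f.
Hypothesis hf0 : f 0 = 0.
Hypothesis hf1 : f 1 = 0.
Hypothesis hfneg : forall s : R, 0 < s < 1 -> f s < 0.
Hypothesis hfpos : forall s : R, 1 < s -> 0 < f s.
Hypothesis hf'1 : derive1 f 1 = 0.

Implicit Types (y z : R).

Let G := extend0 f.
Let F y := primitive G y - primitive G 1.

Let lip M : 0 < M -> exists2 L, 0 < L &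
    forall y z, 0 <= y <= M -> 0 <= z <= M -> `|f y - f z| <= L * `|y - z|.
Proof. by case: hfC1 => f' [df cf']; exact: (C1_lipschitz df cf'). Qed.

Let cG : continuous G. Proof. exact: continuous_extend0 lip. Qed.

Let dF y : is_derive y 1 F (G y).
Proof.
have := is_derive_add (is_derive_primitive y cG) (is_derive_const (- primitive G 1) y).
by rewrite addr0.
Qed.

Let F1 : F 1 = 0. Proof. by rewrite /F subrr. Qed.

Let GE y : 0 <= y -> G y = f y.
Proof. by move=> y0; rewrite /G /extend0 max_l. Qed.

Let GN y : y <= 0 -> G y = 0.
Proof. by move=> y0; rewrite /G /extend0 max_r. Qed.

Let Gneg y : 0 < y < 1 -> G y < 0.
Proof. by move=> /andP[y0 y1]; rewrite GE ?(ltW y0)// hfneg// y0. Qed.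

Let Gpos y : 1 < y -> 0 < G y.
Proof. by move=> y1; rewrite GE ?hfpos// (le_trans ler01)// ltW. Qed.

(** [h], [omega], [T] and [r0] refer to the untruncated [G] and are chosen before [rho]; the
    truncation level, the solutions and the values [dm], [dp] come after it. *)
Lemma shooting k : exists2 Rk : R, 0 < Rk & forall rho, Rk <= rho ->
  exists (g : R -> R) (L : R) (d : bool -> nat -> R) (u v w : bool -> nat -> R -> R),
  [/\ 0 < L, forall y z, `|g y - g z| <= L * `|y - z|, g 0 = 0,
   forall s j, (1 <= j <= 2 * k)%N ->
     [/\ radial_solution n g (d s j) (u s j) (v s j) (w s j),
         forall t, 0 <= t <= rho -> g (u s j t) = extend0 f (u s j t),
         v s j rho = 0, 0 < d s j /\ (if s then 1 < d s j else d s j < 1) &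
         [set r | 0 < r < rho /\ u s j r - 1 = 0] #= `I_(fold_index k j)] &
   forall s t i j, (1 <= i <= 2 * k)%N -> (1 <= j <= 2 * k)%N -> (s, i) <> (t, j) ->
     d s i <> d t j].
Proof.
have pi0 := pi_gt0 R.
have F0 : 0 < F 0 by apply: (potential_gt0 dF F1 GN Gneg Gpos); rewrite eq_sym oner_eq0.
have F2 : 0 < F 2 by apply: (potential_gt0 dF F1 GN Gneg Gpos); rewrite gt_eqF// ltr1n.
(* Half of the lower barrier, so that energy [h] is confined to the well. *)
pose h := Num.min (F 0) (F 2) / 2.
have m0 : 0 < Num.min (F 0) (F 2) by rewrite lt_min F0.
have h0 : 0 < h by rewrite divr_gt0.
have hm : h < Num.min (F 0) (F 2) by rewrite /h; lra.
have hF0 : h < F 0 by move: hm; rewrite lt_min => /andP[].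
have hF2 : h < F 2 by move: hm; rewrite lt_min => /andP[].
have [omega om0 speed] := rotation_speed cG dF F1 GN Gneg Gpos h0 hF0 hF2.
(* Time for [k + 1] half-turns at speed [omega], one more than needed to exceed [k * pi]
   strictly. *)
pose T := k.+1%:R * pi / omega; have T0 : 0 < T by rewrite divr_gt0// mulr_gt0.
(* The three terms secure [r00], [r0T] and [r0h] respectively. *)
pose r0 := 1 + 2 * n%:R * T + 2 * n%:R * T * (1 + h) / h.
have nT0 : 0 <= 2 * n%:R * T by apply: mulr_ge0; [exact: mulr_ge0|exact: ltW].
have nTh0 : 0 <= 2 * n%:R * T * (1 + h) / h by apply: divr_ge0; [apply: mulr_ge0 => //; exact: addr_ge0 (ltW h0)|exact: ltW].
have r00 : 0 < r0.
  by rewrite /r0; move: nT0 nTh0; set x := 2 * _ * T; set y := x * _ / h; lra.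
have r0T : 2 * n%:R * T <= r0.
  by rewrite /r0; move: nT0 nTh0; set x := 2 * _ * T; set y := x * _ / h; lra.
have r0h : 2 * n%:R * T * (1 + h) <= h * r0.
  rewrite -ler_pdivrMl// mulrC /r0; move: nT0 nTh0; set x := 2 * _ * T.
  by set y := x * _ / h; lra.
exists (r0 + T); first exact: addr_gt0.
move=> rho Rrho.
have rho0 : 0 < rho by apply: lt_le_trans Rrho; exact: addr_gt0.
(* Initial values are at most [rho + 2], and a solution rises by at most [rho] on [[0, rho]]. *)
pose M := 2 * rho + 2; have M0 : 0 < M by rewrite /M; lra.
have [L L0 fL] := lip M0.
pose g := truncate f M.
have gL y z : `|g y - g z| <= L * `|y - z| by apply: truncate_lipschitz => //; exact: ltW.
have gC := truncate_bounded M0 (ltW L0) fL.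
have gG y : y <= M -> g y = G y by move=> yM; exact: truncateE.
have g0 : g 0 = 0 by rewrite gG ?(ltW M0)// GN.
have g1 : g 1 = 0 by rewrite gG ?GE ?hf1//; rewrite /M; lra.
have gsgn y : 0 <= g y * (y - 1).
  have [yM|yM] := leP y M; first by rewrite gG//; exact: (torque_ge0 GN Gneg Gpos).
  have M1 : 1 < M by rewrite /M; lra.
  rewrite mulr_ge0 ?subr_ge0 ?(ltW (lt_trans M1 yM))//.
  by rewrite /g /truncate min_r ?(ltW yM)// ltW// Gpos.
have gsmall e : 0 < e -> exists2 del, 0 < del &
     forall y, `|y - 1| <= del -> `|g y| <= e * `|y - 1|.
  move=> e0; case: hfC1 => f' [df _].
  have [del del0 H] := C1_small_near df ltr01 hf1 hf'1 e0.
  exists (Num.min del 1); first by rewrite lt_min del0 ltr01.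
  move=> y; rewrite le_min => /andP[/H Hy]; rewrite ler_norml => /andP[y1 y2].
  by rewrite gG ?GE//; rewrite /M; lra.
have /choice[u /choice[v /choice[w S]]] : forall d, exists u, exists v, exists w, radial_solution n g d u v w.
  by move=> d; have [u [v [w S]]] := ex_radial_solution n L0 gC gL d; exists u, v, w.
have gGu d t : d <= rho + 2 -> 0 <= t <= rho -> g (u d t) = G (u d t).
  move=> dr /andP[t0 tr]; apply: gG; have := step_unit_speed t 0 (S d).
  by rewrite (step_u0 (S d)) subr0 (ger0_norm t0) ler_norml /M => /andP[_]; lra.
have l0 : 0 < (r0 ^+ n)^-1 by rewrite invr_gt0 exprn_gt0.
pose th d := angle n g (r0 ^+ n)^-1 (u d) (v d) (w d) rho.
have cth d : d != 1 -> {for d, continuous th}.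
  by move=> d1; apply: (continuous_angle L0 gL g1 l0 S (ltW rho0) d1).
have thsmall d : d != 1 -> (forall t, 0 <= t <= rho -> u d t != 1) -> th d < pi / 2.
  by move=> d1 ud; apply: (angle_lt_pihalf L0 gL g1 l0 (S d) d1 (ltW rho0)).
pose E d := Num.sqrt (1 + v d r0 ^+ 2) - 1 + F (u d r0).
have cE : continuous E.
  have cu : continuous (fun d => u d r0).
    move=> d; apply: (@continuous_lipschitz _ _ (2 * expR (L * r0 ^+ 2))) => d'.
    by have := solution_dependence L0 gL (S d') (S d) (ltW r00); rewrite mulrAC.
  have cv : continuous (fun d => v d r0).
    move=> d; apply: (@continuous_lipschitz _ _ (L * (2 * expR (L * r0 ^+ 2)) * r0)) => d'.
    exact: (solution_v_dependence L0 gL S d' d (ltW r00)).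
  apply: continuous_add; last first.
    by apply: continuous_composite => // y; exact: is_derive_continuous (dF y).
  apply: continuous_add; last exact: continuous_const.
  apply: (@continuous_composite _ (fun y => Num.sqrt (1 + y ^+ 2))) => // y.
  exact: is_derive_continuous (is_derive_sqrt1D y).
(* [u] and [v] come from a choice; uniqueness identifies them with the constant solution at a zero
   of [g]. *)
have const c : g c = 0 -> u c r0 = c /\ v c r0 = 0.
  move=> gc; have Sc := constant_solution n gc; split; apply/eqP; rewrite -subr_eq0 -normr_le0.
    apply: le_trans (solution_dependence L0 gL (S c) Sc (ltW r00)) _.
    by rewrite subrr normr0 mulr0 mul0r.
  have := step_v_dist (B := 0) (S c) Sc (ltW r00); rewrite mul0r; apply=> t /andP[t0 _].
  apply: le_trans (gL _ _) _; rewrite -(mulr0 L) ler_pM2l//.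
  apply: le_trans (solution_dependence L0 gL (S c) Sc t0) _.
  by rewrite subrr normr0 mulr0 mul0r.
have Ec c : g c = 0 -> E c = F c.
  by move=> /const[uc vc]; rewrite /E uc vc expr0n addr0 sqrtr1 subrr add0r.
have rho2 : 1 <= rho + 2 by lra.
(* The energy at [r0] is [F 0] for [d = 0] and vanishes for [d = 1]. *)
have [dm dm01 Edm] : exists2 d, 0 < d < 1 & E d = h.
  apply: (ivt_between ler01 (fun x _ => cE x)); apply/orP; right.
  by rewrite !Ec// F1 h0 hF0.
(* From [rho + 2], unit speed leaves [u] at least 2 at time [r0], where the potential alone exceeds
   [h]. *)
have [dp dp1 Edp] : exists2 d, 1 < d < rho + 2 & E d = h.
  apply: (ivt_between rho2 (fun x _ => cE x)); apply/orP; left; rewrite Ec// F1 h0/=.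
  apply: (lt_le_trans hF2); rewrite /E -[X in X <= _]add0r; apply: lerD.
    by rewrite subr_ge0 sqrt1D_ge1.
  apply: (potential_le dF Gpos); first lra.
  have := step_unit_speed r0 0 (S (rho + 2)).
  by rewrite (step_u0 (S _)) subr0 (gtr0_norm r00) ler_norml => /andP[]; lra.
have thbig d : 0 < d < rho + 2 -> d != 1 -> E d = h -> k%:R * pi < th d.
  move=> /andP[d0 dr] d1 Ed.
  have rot := @angle_after_rotation _ _ _ dF F1 GN Gneg Gpos n h omega T r0 h0 om0 speed T0 r00 r0T r0h.
  have gGt t : r0 <= t <= r0 + T -> g (u d t) = G (u d t).
    by move=> /andP[t1 t2]; apply: gGu; [exact: ltW|rewrite (le_trans (ltW r00))//= (le_trans t2)].
  have H1 := rot g L d (u d) (v d) (w d) L0 gL (S d) gGt d1 gsgn g1 Ed.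
  have H2 : angle n g (r0 ^+ n)^-1 (u d) (v d) (w d) (r0 + T) <= th d.
    by apply: (angle_le L0 gL g1 gsgn l0 (S d) d1) => //; rewrite addr_ge0// ltW.
  apply: lt_le_trans H2; apply: lt_le_trans H1.
  rewrite /T (mulrC omega) divfK ?gt_eqF//.
  by rewrite ltr_pM2r// ltr_nat.
have [eta0 eta00 small0] := solution_lt1_of_small n L0 gL rho g0.
have [eta1 eta10 small1] := solution_neq1_of_near1 n L0 gL (ltW rho0) g1 gsmall.
have /andP[dm0 dm1] := dm01; have /andP[dp1' dp2] := dp1.
have dm_ne : dm != 1 by rewrite lt_eqF.
have dp_ne : dp != 1 by rewrite gt_eqF.
have thm : k%:R * pi < th dm.
  by apply: thbig => //; rewrite dm0 (lt_le_trans dm1).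
have thp : k%:R * pi < th dp.
  by apply: thbig => //; rewrite dp2 andbT (lt_trans ltr01).
pose P s j d := th d = (fold_index k j)%:R * pi /\ shooting_range dm dp (rho + 2) k s j d.
have exP s j : exists d, (1 <= j <= 2 * k)%N -> P s j d.
  have [jk|jk] := boolP (1 <= j <= 2 * k)%N; last by exists 0.
  have [|||d Pd] := @shooting_ranges_hit _ th dm dp (rho + 2) eta0 eta1 k cth dm01 dp1 thm thp
    eta00 eta10 _ _ _ s j jk.
  - by move=> d d1 dd0; apply: thsmall => // t; exact: (small0 _ _ _ _ _ (S d)).
  - move=> d dd0; apply: thsmall => [|t]; last exact: (small1 _ _ _ _ _ (S d)).
    by case/andP: dd0; rewrite normr_gt0 subr_eq0.
  - apply: thsmall => [|t]; last exact: (solution_gt1_of_large (S (rho + 2))).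
    by rewrite gt_eqF// (lt_trans dp1').
  by exists d.
have /choice[dd Hd] : forall s : bool, exists d : nat -> R, forall j, (1 <= j <= 2 * k)%N -> P s j (d j).
  by move=> s; have [d Hd] := choice (exP s); exists d => j; exact: Hd.
exists g, L, dd, (fun s j => u (dd s j)), (fun s j => v (dd s j)), (fun s j => w (dd s j)).
split => //.
- move=> s j jk; have [Eth Hdd] := Hd s j jk.
  have [d0 dr ds] := shooting_range_bounds dm01 dp1 Hdd.
  have d1 : dd s j != 1 by case: (s) ds => ds; [rewrite gt_eqF|rewrite lt_eqF].
  have [zeros vr] := angle_zeros L0 gL g1 gsgn l0 (S (dd s j)) d1 rho0 Eth.
  by split => // t; exact: gGu.
(* Equal initial values have equal angles at [rho], hence equal folded indices; the range then fixes
   the sign and the half of the index set. *)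
- move=> s t i j ik jk neq E1.
  have [Ei Hi] := Hd s i ik; have [Ej Hj] := Hd t j jk.
  move: Ei Hi; rewrite E1 Ej => /(mulIf (lt0r_neq0 pi0))/eqP.
  rewrite eqr_nat => /eqP Eij Hi.
  have [st ij] := shooting_range_inj dm01 dp1 Hi Hj.
  by apply: neq; rewrite st (fold_index_inj ik jk ij (esym Eij)).
Qed.

End shooting.

(** * From profiles to solutions in the ball *)

Section one_sided_derivative.
Variable R : realType.
Implicit Types (D : set R) (f h : R -> R) (x y a : R).

(** Carathéodory's form of the derivative, which restricts to any domain. *)
Lemma has_deriv_on_slope D f x h : {for x, continuous h} ->
  (forall y, D y -> f y - f x = h y * (y - x)) ->
  (f y - f x) / (y - x) @[y --> within D x^'] --> h x.
Proof.
move=> ch hE; apply/cvgrPdist_le => e e0.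
have /cvgrPdist_le /(_ e e0) [del/= del0 H] := ch.
exists del => //= y yx yN Dy; rewrite (hE _ Dy) mulfK ?subr_eq0//.
exact: H.
Qed.

Lemma has_deriv_on_is_derive D f x a : is_derive x 1 f a ->
  (f y - f x) / (y - x) @[y --> within D x^'] --> a.
Proof.
move=> /is_derive1_caratheodory [h [hE ch hx]]; rewrite -hx.
by apply: has_deriv_on_slope => // y _; exact: hE.
Qed.

End one_sided_derivative.

Section profile.
Variables (R : realType) (n : nat) (g : R -> R) (L d : R) (u v w : R -> R).
Hypothesis L0 : 0 < L.
Hypothesis gL : forall y z, `|g y - g z| <= L * `|y - z|.
Hypothesis S : radial_solution n g d u v w.
Implicit Types (r t x y rho : R).

(* A minimum of u at a level m <= 0 would be an equilibrium, as g vanishes there. *)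
Lemma solution_positive rho : 0 < rho -> v rho = 0 -> 0 < d ->
  (forall t, 0 <= t <= rho -> u t <= 0 -> g (u t) = 0) ->
  forall t, 0 <= t <= rho -> 0 < u t.
Proof.
move=> rho0 vrho d0 gN t trho; rewrite ltNge; apply/negP => ut.
have [c crho Hc] := EVT_min (ltW rho0) (continuous_subspaceT (step_continuous S)).
have uc : u c <= 0 by apply: le_trans ut; apply: Hc; rewrite in_itv.
have /andP[c0 cr] : 0 <= c <= rho by move: crho; rewrite in_itv.
have gc : g (u c) = 0 by apply: gN => //; rewrite c0.
have dc : d != u c by rewrite gt_eqF// (le_lt_trans uc).
have cN0 : c != 0 by apply/eqP => ce; move: uc; rewrite ce (step_u0 S) leNgt d0.
(* A minimum at [rho] is covered by the Neumann condition, an interior one by Fermat's rule. *)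
have vc : v c = 0.
  move: cr; rewrite le_eqVlt => /predU1P[->//|cr].
  have cp : 0 < c by rewrite lt_neqAle eq_sym cN0.
  have H : is_derive c 1 u 0.
    apply: (@derive1_at_min _ u 0 rho c (ltW rho0)).
    - by move=> y _; case: (step_u S y).
    - by rewrite in_itv/= cp.
    - by move=> y; rewrite in_itv/= => /andP[y0 yr]; apply: Hc; rewrite in_itv/= !ltW.
  have := @derive_val _ _ _ _ _ _ _ (step_u S c).
  rewrite (@derive_val _ _ _ _ _ _ _ H) => /esym/eqP.
  by rewrite psi_eq0 => /eqP.
have := solution_nonvanishing L0 gL S gc dc c0 erefl.
by rewrite (step_wv S c0) vc mulr0 eqxx.
Qed.

Let q0 : R := - g d / n.+1%:R.

(* v(r) / r, extended by continuity. *)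
Definition slope_ratio r : R := if r <= 0 then - g d / n.+1%:R else v r / r.

Lemma slope_ratioE r : 0 <= r -> v r = slope_ratio r * r.
Proof.
rewrite /slope_ratio le_eqVlt => /predU1P[<-|r0]; first by rewrite mulr0 (step_vN S).
by rewrite leNgt r0/= divfK// gt_eqF.
Qed.

Lemma slope_ratio0 : slope_ratio 0 = - g d / n.+1%:R.
Proof. by rewrite /slope_ratio lexx. Qed.

(** [w + g(d) r^(n+1) / (n+1)] has derivative [- r^n (g(u) - g(d))], of size at most [L r^(n+1)] by
    the speed bound. *)
Lemma slope_ratio_dist r : `|slope_ratio r - slope_ratio 0| <= L * `|r|.
Proof.
rewrite slope_ratio0 /slope_ratio; case: (leP r 0) => [_|r0].
  by rewrite subrr normr0 mulr_ge0// ltW.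
rewrite -/q0.
have rn0 : 0 < r ^+ n.+1 by rewrite exprn_gt0.
rewrite -(ler_pM2l rn0) -{1}(gtr0_norm rn0) -normrM (gtr0_norm r0).
have nN : n.+1%:R != 0 :> R by rewrite pnatr_eq0.
have -> : r ^+ n.+1 * (v r / r - q0) = w r + g d / n.+1%:R * r ^+ n.+1.
  have rN : r != 0 by rewrite gt_eqF.
  rewrite (step_wv S (ltW r0)) /q0 exprS; set N := n.+1%:R in nN *; field.
  by rewrite nat1r nN rN.
have dW t : is_derive t 1 (fun t => w t + g d / n.+1%:R * t ^+ n.+1) (- (t ^+ n * (g (u t) - g d))).
  have h := is_derive_add (step_w S t) (is_derive_mul (is_derive_const (g d / n.+1%:R) t)
    (is_derive_pow n.+1 (is_derive_id t (1 : R)))).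
  by apply: (is_derive_eq h); rewrite /=; set N := n.+1%:R in nN *; field.
have dG t : is_derive t 1 (fun t => r ^+ n * (L * r) * t) (r ^+ n * (L * r)).
  have := is_derive_mul (is_derive_const (r ^+ n * (L * r)) t) (is_derive_id t (1:R)).
  by rewrite mul0r add0r mulr1.
have := is_derive_norm_le (ltW r0) (fun t _ => dW t) (fun t _ => dG t).
rewrite (step_w0 S) expr0n !mulr0 !addr0 !subr0 => h.
rewrite (_ : r ^+ n.+1 * (L * r) = r ^+ n * (L * r) * r); last by rewrite exprS; ring.
apply: h => t /andP[t0 tr]; rewrite normrN normrM ger0_norm ?exprn_ge0 ?(ltW t0)//.
apply: ler_pM => //; first by rewrite exprn_ge0// ltW.
  by rewrite lerXn2r ?nnegrE// ltW.
apply: le_trans (gL _ _) _; rewrite ler_pM2l//.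
have := step_unit_speed t 0 S; rewrite (step_u0 S) subr0 (gtr0_norm t0) => h'.
exact: le_trans h' (ltW tr).
Qed.

Lemma is_derive_slope_ratio r : 0 < r ->
  is_derive r 1 slope_ratio ((- g (u r) - n.+1%:R * slope_ratio r) / r).
Proof.
move=> r0; have rN : r != 0 by rewrite gt_eqF.
apply: (@near_eq_is_derive _ _ _ (fun t => v t * t^-1)).
  by apply: filterS (lt_nbhsr r0) => y y0; rewrite /slope_ratio leNgt y0.
have h := is_derive_mul (is_derive_v S r0) (is_derive_inv (is_derive_id r (1 : R)) rN).
apply: (is_derive_eq h); rewrite /slope_ratio leNgt r0/= -natr1; field.
exact: rN.
Qed.

Lemma continuous_slope_ratio : continuous slope_ratio.
Proof.
move=> r; have [r0|r0|->] := ltgtP r 0.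
- apply: (@near_eq_continuous _ _ (fun=> q0)); last exact: cvg_cst.
  by apply: filterS (lt_nbhsl r0) => y y0; rewrite /slope_ratio ltW.
- exact: is_derive_continuous (is_derive_slope_ratio r0).
- by apply: (@continuous_lipschitz _ _ L) => y; rewrite subr0; exact: slope_ratio_dist.
Qed.

(** In [u'' = psi'(v) v'] the singular term [n v / r] becomes [n * slope_ratio r], which is
    continuous up to 0. *)
Lemma solution_classical_profile rho : classical_profile rho u.
Proof.
pose s r := (Num.sqrt (1 + v r ^+ 2))^-1.
have cs : continuous s.
  move=> r; apply: (@continuousV _ _ (fun r => Num.sqrt (1 + v r ^+ 2))).
    by rewrite gt_eqF// sqrt1D_gt0.
  apply: (@continuous_composite _ (fun y => Num.sqrt (1 + y ^+ 2)) v) => [y|].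
    exact: is_derive_continuous (is_derive_sqrt1D y).
  exact: step_v S.
have cg : continuous g by move=> y; apply: continuous_lipschitz => z; exact: gL.
pose u'' r := s r ^+ 3 * (- g (u r) - n%:R * slope_ratio r).
have cu'' : continuous u''.
  apply: continuous_mul; first exact: continuous_pow.
  apply: continuous_add; apply: continuous_opp.
    by apply: continuous_composite => //; exact: step_continuous S.
  by apply: continuous_mul; [exact: continuous_const|exact: continuous_slope_ratio].
exists (fun r => psi (v r)); split.
- by move=> r _; apply: has_deriv_on_is_derive; exact: step_u S r.
- exists u''; split; last exact: continuous_subspaceT.
  move=> r /=; rewrite in_itv/= => /andP[]; rewrite le_eqVlt => /predU1P[<- _|r0 _].
    (* At 0 the difference quotient of [u'] is [slope_ratio y * s y], and [- g d + n g(d) / (n + 1)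
       = - g(d) / (n + 1)]. *)
    have -> : u'' 0 = slope_ratio 0 * s 0.
      rewrite /u'' /s (step_vN S)// expr0n addr0 sqrtr1 invr1 expr1n mul1r mulr1.
      rewrite (step_uN S)// slope_ratio0 -natr1; field.
      by rewrite natr1 pnatr_eq0.
    apply: (@has_deriv_on_slope _ _ _ _ (fun r => slope_ratio r * s r)).
      by apply: continuous_mul => //; exact: continuous_slope_ratio.
    move=> y; rewrite /= in_itv/= => /andP[y0 _].
    rewrite (step_vN S (lexx 0)) psi0 !subr0 /psi -/(s y) {1}(slope_ratioE y0); ring.
  apply: has_deriv_on_is_derive.
  have h := is_derive_composite (is_derive_psi (v r)) (is_derive_v S r0).
  by apply: (is_derive_eq h); rewrite /u'' /s /slope_ratio leNgt r0/=; ring.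
- by move=> r _; exact: psi_norm_lt1.
Qed.

End profile.

(** * Derivatives of functions of several variables *)

Section several_variables.
Variables (R : realType) (V : normedModType R).
Implicit Types (f : V -> R) (x v : V).

Lemma is_derive1P f x v a :
  is_derive x v f a <-> is_derive (0 : R) (1 : R) (fun h : R => f (h *: v + x)) a.
Proof.
have E : 'D_v f x = 'D_1 (fun h : R => f (h *: v + x)) (0 : R).
  rewrite /derive; set g1 := fun h => h^-1 *: _; set g2 := fun h => h^-1 *: _.
  suff -> : g1 = g2 by [].
  by rewrite funeqE /g1 /g2 => h /=; rewrite addr0 scale0r add0r [_%:A]mulr1.
split=> -[df <-].
  by apply: DeriveDef; [exact: (proj1 (derivable1P f x v))|rewrite E].
by apply: DeriveDef; [exact: (proj2 (derivable1P f x v))|rewrite E].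
Qed.

Lemma is_derive_compose f (p : R -> R) x v a b :
  is_derive (f x) 1 p b -> is_derive x v f a -> is_derive x v (fun y => p (f y)) (b * a).
Proof.
move=> dp /is_derive1P df; apply/is_derive1P.
by apply: (@is_derive_composite _ p (fun h : R => f (h *: v + x))) => //; rewrite scale0r add0r.
Qed.

Lemma differentiable_compose f (p : R -> R) x b :
  is_derive (f x) 1 p b -> differentiable f x -> differentiable (fun y => p (f y)) x.
Proof.
move=> [dp _] df; apply: (@differentiable_comp _ _ _ _ f p) => //.
exact/derivable1_diffP.
Qed.

Lemma differentiable_quadratic f (K : R) : 0 <= K ->
  (forall y, `|f y - f 0| <= K * `|y| ^+ 2) -> differentiable f 0.
Proof.
move=> K0 H; pose l : {linear V -> R} := \0.
have cl : continuous l by move=> y; exact: cvg_cst.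
have ol : f \o shift 0 = cst (f 0) + l +o_ (0 : V) id.
  apply/eqaddoP => e e0; have K1 : 0 < K + 1 by lra.
  have : \forall h \near (0 : V), `|h| < e / (K + 1) by apply: nbhs0_lt; rewrite divr_gt0.
  apply: filterS => h; rewrite ltr_pdivlMr// => he; rewrite /= !fctE /= !addr0.
  apply: le_trans (H h) _; rewrite expr2 mulrA ler_wpM2r//.
  by apply: le_trans (ltW he); rewrite mulrC ler_wpM2l//; lra.
have dl : 'd f (0 : V) = l :> (V -> R) by apply: diff_unique.
by apply/diff_locallyP; rewrite dl.
Qed.

End several_variables.

(** * The Euclidean norm *)

Section euclidean.
Variables (R : realType) (n : nat).
Local Notation V := 'rV[R]_n.+1.
Implicit Types (x y : V) (i : 'I_n.+1).

Let sq x : R := \sum_(i < n.+1) x 0 i ^+ 2.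

Lemma sq_ge0 x : 0 <= sq x.
Proof. by apply: sumr_ge0 => i _; exact: sqr_ge0. Qed.

Lemma enorm_ge0 x : 0 <= enorm x. Proof. exact: sqrtr_ge0. Qed.

Lemma enorm_sq x : enorm x ^+ 2 = sq x.
Proof. by rewrite sqr_sqrtr// sq_ge0. Qed.

Lemma enorm_eq0 x : (enorm x == 0) = (x == 0).
Proof.
rewrite -sqrf_eq0 enorm_sq; apply/eqP/eqP => [sx|->]; last first.
  by rewrite /sq big1// => i _; rewrite mxE expr0n.
apply/rowP => i; rewrite mxE; apply/eqP; rewrite -sqrf_eq0; apply/eqP.
by move/psumr_eq0P : sx; apply => // j _; exact: sqr_ge0.
Qed.

Lemma enorm0 : enorm (0 : V) = 0.
Proof. by apply/eqP; rewrite enorm_eq0. Qed.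

Lemma enorm_gt0 x : (0 < enorm x) = (x != 0).
Proof. by rewrite lt_neqAle enorm_ge0 andbT eq_sym enorm_eq0. Qed.

Lemma coord_le_norm x i : `|x 0 i| <= `|x|.
Proof.
have -> : `|x| = mx_norm x by [].
by rewrite mx_normrE; apply: (le_bigmax _ (fun ij => `|x ij.1 ij.2|) (0, i)).
Qed.

(** Differentiability refers to the sup norm, so Euclidean bounds have to be converted; a crude
    constant suffices. *)
Lemma enorm_le_norm x : enorm x <= n.+1%:R * `|x|.
Proof.
rewrite -(@ler_pXn2r _ 2)// ?nnegrE ?enorm_ge0 ?mulr_ge0// enorm_sq exprMn.
apply: (@le_trans _ _ (\sum_(i < n.+1) `|x| ^+ 2)).
  apply: ler_sum => i _; rewrite -(real_normK (num_real _)).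
  by rewrite lerXn2r ?nnegrE// coord_le_norm.
rewrite sumr_const card_ord -(mulr_natl (`|x| ^+ 2)) ler_wpM2r ?exprn_ge0//.
by rewrite -natrX ler_nat -mulnn leq_pmulr.
Qed.

Lemma enormZ (a : R) x : enorm (a *: x) = `|a| * enorm x.
Proof.
rewrite /enorm -sqrtr_sqr -sqrtrM ?sqr_ge0//; congr Num.sqrt.
by rewrite mulr_sumr; apply: eq_bigr => i _; rewrite mxE exprMn.
Qed.

Lemma is_derive_coord x v i : is_derive x v (fun y : V => y 0 i) (v 0 i).
Proof.
apply/is_derive1P.
have h := is_derive_add (is_derive_mul (is_derive_id (0 : R) (1 : R)) (is_derive_const (v 0 i) 0))
  (is_derive_const (x 0 i) 0).
rewrite mul1r mulr0 !addr0 in h.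
by move: h; congr is_derive; apply/funext => y; rewrite !mxE.
Qed.

Let is_derive_sq x i : is_derive x (delta_mx 0 i) sq (2 * x 0 i).
Proof.
apply/is_derive1P.
have h j : is_derive (0 : R) (1 : R) (fun h : R => ((h *: delta_mx 0 i + x) : V) 0 j ^+ 2)
    (2 * x 0 j * (j == i)%:R).
  have /is_derive1P := is_derive_coord x (delta_mx 0 i) j => hj.
  have := is_derive_pow 2 hj; rewrite scale0r add0r expr1 mxE eqxx/=.
  by [].
have := @is_derive_sum _ _ _ n.+1 (fun j => fun h : R => ((h *: delta_mx 0 i + x) : V) 0 j ^+ 2) 0 1 _ h.
have -> : \sum_(j < n.+1) 2 * x 0 j * (j == i)%:R = 2 * x 0 i.
  rewrite (bigD1 i)//= eqxx mulr1 big1 ?addr0// => j /negbTE ->.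
  by rewrite mulr0.
by congr is_derive; apply/funext => y; rewrite fct_sumE.
Qed.

Let differentiable_sq x : differentiable sq x.
Proof.
have := @differentiable_sum _ _ _ n.+1 (fun i (y : V) => y 0 i ^+ 2) x.
rewrite (_ : \sum_i _ = sq); last by apply/funext => y; rewrite fct_sumE.
apply => i; have h := is_derive_pow 2 (is_derive_id (x 0 i) (1 : R)).
exact: (@differentiable_compose _ _ (fun y : V => y 0 i) _ _ _ h (differentiable_coord _ _ _)).
Qed.

Let is_derive_sqrt_sq x : x != 0 -> is_derive (sq x) 1 Num.sqrt (2 * enorm x)^-1.
Proof. by rewrite -enorm_gt0 /enorm sqrtr_gt0; exact: is_derive1_sqrt. Qed.

Lemma is_derive_enorm x i : x != 0 ->
  is_derive x (delta_mx 0 i) (@enorm R n.+1) (x 0 i / enorm x).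
Proof.
move=> x0; have e0 : enorm x != 0 by rewrite gt_eqF// enorm_gt0.
have h := is_derive_compose (is_derive_sqrt_sq x0) (is_derive_sq x i).
by apply: (is_derive_eq h); field.
Qed.

Lemma differentiable_enorm x : x != 0 -> differentiable (@enorm R n.+1) x.
Proof. by move=> x0; exact: differentiable_compose (is_derive_sqrt_sq x0) (differentiable_sq x). Qed.

End euclidean.

Lemma is_derive_quadratic (R : realType) (p : R -> R) (a K : R) :
  (forall z, `|p z - p 0 - a * z| <= K * `|z| ^+ 2) -> is_derive (0 : R) (1 : R) p a.
Proof.
move=> H; apply/is_derive1_caratheodory.
exists (fun z => if z == 0 then a else (p z - p 0) / z); split; last by rewrite eqxx.
  by move=> z; rewrite subr0; case: eqP => [->|/eqP z0]; rewrite ?divfK// subrr mulr0.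
apply: (@continuous_lipschitz _ _ K) => z; rewrite eqxx subr0.
case: eqP => [->|/eqP z0]; first by rewrite subrr !normr0 mulr0.
have zp : 0 < `|z| by rewrite normr_gt0.
have -> : (p z - p 0) / z - a = (p z - p 0 - a * z) / z by field.
by rewrite normrM normfV ler_pdivrMr// -mulrA -expr2.
Qed.

(** * Gradient, flux and divergence of the radial extension *)

Section radial_field.
Variables (R : realType) (n : nat) (g : R -> R) (L d : R) (u v w : R -> R).
Hypothesis L0 : 0 < L.
Hypothesis gL : forall y z, `|g y - g z| <= L * `|y - z|.
Hypothesis S : radial_solution n g d u v w.
Local Notation V := 'rV[R]_n.+1.
Local Notation q := (slope_ratio n g d v).
Let U : V -> R := radial_ext u.
Implicit Types (x y : V) (i : 'I_n.+1) (r t : R).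

(** For [r <= 1] the speed is at most linear in [r]; for [r >= 1] unit speed suffices, as
    [r <= r^2]. *)
Lemma solution_quadratic r : 0 <= r -> `|u r - u 0| <= (`|q 0| + L + 1) * r ^+ 2.
Proof.
move=> r0; have [r1|/ltW r1] := leP 1 r.
  have := step_unit_speed r 0 S; rewrite subr0 (ger0_norm r0) => h; apply: le_trans h _.
  apply: (@le_trans _ _ (1 * r ^+ 2)).
    by rewrite mul1r expr2 ler_peMl.
  by rewrite ler_wpM2r ?sqr_ge0// lerDr addr_ge0// ltW.
have vb t : 0 <= t <= r -> `|v t| <= (`|q 0| + L) * r.
  move=> /andP[t0 tr]; rewrite (slope_ratioE S t0) normrM (ger0_norm t0).
  apply: ler_pM => //; have := ler_normD (q t - q 0) (q 0); rewrite subrK => h.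
  apply: le_trans h _; rewrite addrC lerD2l.
  apply: le_trans (slope_ratio_dist L0 gL S t) _.
  by rewrite (ger0_norm t0) ler_piMr ?(ltW L0)// (le_trans tr).
have dG t : is_derive t 1 (fun t => (`|q 0| + L) * r * t) ((`|q 0| + L) * r).
  have := is_derive_mul (is_derive_const ((`|q 0| + L) * r) t) (is_derive_id t (1:R)).
  by rewrite mul0r add0r mulr1.
have := is_derive_norm_le r0 (fun t _ => step_u S t) (fun t _ => dG t).
rewrite mulr0 subr0 => h.
apply: (@le_trans _ _ ((`|q 0| + L) * r * r)).
  apply: h => t /andP[t0 tr]; apply: le_trans (psi_norm_le _) _.
  by apply: vb; rewrite !ltW.
by rewrite -mulrA -expr2 ler_wpM2r ?sqr_ge0// lerDl.
Qed.

Lemma is_derive_radial x i :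
  is_derive x (delta_mx 0 i) U (psi (v (enorm x)) * (x 0 i / enorm x)).
Proof.
have [->|x0] := eqVneq x 0; last first.
  exact: is_derive_compose (step_u S _) (is_derive_enorm i x0).
(* At the origin the formula evaluates to 0, which is the derivative because [u - u 0] is
   quadratically small. *)
rewrite mxE mul0r mulr0; apply/is_derive1P.
pose K := (`|q 0| + L + 1) * enorm (delta_mx 0 i : V) ^+ 2.
apply: (@is_derive_quadratic _ _ _ K) => z.
rewrite mul0r subr0 !addr0 scale0r /U /radial_ext enorm0 enormZ.
apply: le_trans (solution_quadratic _) _; first by rewrite mulr_ge0 ?enorm_ge0.
by rewrite exprMn /K mulrA mulrAC.
Qed.

Lemma differentiable_radial x : differentiable U x.
Proof.
have [->|x0] := eqVneq x 0; last first.
  exact: differentiable_compose (step_u S _) (differentiable_enorm x0).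
pose K := (`|q 0| + L + 1) * n.+1%:R ^+ 2.
have K1 : 0 <= `|q 0| + L + 1 by rewrite !addr_ge0// ltW.
apply: (@differentiable_quadratic _ _ _ K) => [|y]; first by rewrite mulr_ge0 ?sqr_ge0.
rewrite /U /radial_ext enorm0; apply: le_trans (solution_quadratic (enorm_ge0 y)) _.
rewrite /K -mulrA -exprMn ler_wpM2l// lerXn2r ?nnegrE ?enorm_ge0 ?mulr_ge0//.
exact: enorm_le_norm.
Qed.

Lemma grad_radial x : grad U x = (psi (v (enorm x)) / enorm x) *: x.
Proof.
apply/rowP => i; rewrite !mxE.
have dU := is_derive_radial x i; rewrite (@derive_val _ _ _ _ _ _ _ dU).
by rewrite mulrA mulrAC.
Qed.

(** The flux is [v(r) x / r], and the continuous ratio [q] removes the division at the origin. *)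
Lemma minkowski_flux_radial : minkowski_flux U = (fun x => q (enorm x) *: x).
Proof.
apply/funext => x; rewrite /minkowski_flux grad_radial.
have [->|x0] := eqVneq x 0; first by rewrite !scaler0.
have e0 : 0 < enorm x by rewrite enorm_gt0.
rewrite enormZ normrM normfV (gtr0_norm e0) divfK ?gt_eqF// real_normK ?num_real//.
rewrite scalerA mulrA psi_flux; congr (_ *: _).
by rewrite (slope_ratioE S (ltW e0)) mulfK// gt_eqF.
Qed.

Lemma differentiable_flux_coord x i : differentiable (fun y : V => q (enorm y) * y 0 i) x.
Proof.
have [->|x0] := eqVneq x 0; last first.
  apply: differentiableM; last exact: differentiable_coord.
  apply: (differentiable_compose _ (differentiable_enorm x0)).
  by apply: (is_derive_slope_ratio S); rewrite enorm_gt0.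
(* The linear part is split off; the remainder is quadratically small because [q] is Lipschitz at
   0. *)
rewrite (_ : (fun y : V => _) = (fun y : V => q 0 * y 0 i) + (fun y => (q (enorm y) - q 0) * y 0 i)); last first.
  by apply/funext => y; rewrite fctE; ring.
apply: differentiableD.
  by apply: differentiableM; [exact: differentiable_cst|exact: differentiable_coord].
apply: (@differentiable_quadratic _ _ _ (L * n.+1%:R)) => [|y]; first by rewrite mulr_ge0// ltW.
rewrite mxE mulr0 subr0 normrM expr2 mulrA; apply: ler_pM => //; last exact: coord_le_norm.
apply: le_trans (slope_ratio_dist L0 gL S _) _.
by rewrite -mulrA ler_pM2l// ger0_norm ?enorm_ge0// enorm_le_norm.
Qed.

Lemma differentiable_flux x : differentiable (minkowski_flux U) x.
Proof.
rewrite minkowski_flux_radial.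
rewrite (_ : (fun y : V => _) = \sum_(i < n.+1) (fun y : V => (q (enorm y) * y 0 i) *: (delta_mx 0 i : V))).
  apply: differentiable_sum => i; apply: differentiableZl.
  exact: differentiable_flux_coord.
apply/funext => y; rewrite fct_sumE {2}(row_sum_delta y) scaler_sumr.
by apply: eq_bigr => i _; rewrite scalerA.
Qed.

(** With [N = n + 1], [div (q x) = r q' + N q] and [r q' = - g(u) - N q]; at the origin the sum is
    [N q(0) = - g(d)]. *)
Lemma divergence_flux x : divergence (minkowski_flux U) x = - g (u (enorm x)).
Proof.
have nN : n.+1%:R != 0 :> R by rewrite pnatr_eq0.
rewrite minkowski_flux_radial /divergence.
transitivity (\sum_(i < n.+1) 'D_(delta_mx 0 i) (fun y : V => q (enorm y) * y 0 i) x).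
  by apply: eq_bigr => i _; congr ('D_(_) _ x); apply/funext => y; rewrite mxE.
have [->|x0] := eqVneq x 0.
  rewrite enorm0 (step_u0 S); transitivity (\sum_(i < n.+1) q 0).
    apply: eq_bigr => i _.
    suff dq : is_derive (0 : V) (delta_mx 0 i) (fun y : V => q (enorm y) * y 0 i) (q 0).
      exact: (@derive_val _ _ _ _ _ _ _ dq).
    apply/is_derive1P; apply: (@is_derive_quadratic _ _ _ (L * enorm (delta_mx 0 i : V))) => z.
    rewrite scale0r !addr0 enormZ !mxE !eqxx mulr1 mulr0 subr0 -mulrBl normrM expr2 !mulrA.
    rewrite ler_wpM2r//; apply: le_trans (slope_ratio_dist L0 gL S _) _.
    by rewrite normrM normr_id (ger0_norm (enorm_ge0 _)) mulrAC mulrA.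
  by rewrite sumr_const card_ord slope_ratio0 -(mulr_natr (_ / _)) divfK.
have e0 : 0 < enorm x by rewrite enorm_gt0.
have eN : enorm x != 0 by rewrite gt_eqF.
pose q' := (- g (u (enorm x)) - n.+1%:R * q (enorm x)) / enorm x.
transitivity (\sum_(i < n.+1) (q' / enorm x * x 0 i ^+ 2 + q (enorm x))).
  apply: eq_bigr => i _.
  have dq := is_derive_compose (is_derive_slope_ratio S e0) (is_derive_enorm i x0).
  have dp := is_deriveM dq (is_derive_coord x (delta_mx 0 i) i).
  rewrite (@derive_val _ _ _ _ _ _ _ dp) mxE !eqxx /GRing.scale/= -/q'.
  by field.
rewrite big_split/= -mulr_sumr sumr_const card_ord -[X in _ * X]enorm_sq -(mulr_natl (q _)) /q'.
by field.
Qed.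

(** Along the normal line [enorm] is [rho + t], so the normal derivative is
    [u'(rho) = psi (v rho) = 0]. *)
Lemma neumann_bc_radial rho : 0 < rho -> v rho = 0 -> neumann_bc rho U.
Proof.
move=> rho0 vrho x; rewrite /esphere /= => xr.
have /is_derive1_caratheodory [h [hE ch hx]] := step_u S rho.
rewrite vrho psi0 in hx.
apply/cvgrPdist_le => e e0.
have /cvgrPdist_le /(_ e e0) [del/= del0 H] := ch.
exists (Num.min del rho) => /=; first by rewrite lt_min del0.
move=> t /=; rewrite sub0r normrN lt_min => /andP[t1 t2] tneg.
have rt : 0 <= rho + t by move: t2; rewrite ltr_norml => /andP[]; lra.
have E : enorm (x + t *: (rho^-1 *: x)) = rho + t.
  rewrite scalerA -{1}(scale1r x) -scalerDl enormZ xr.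
  rewrite -{2}(gtr0_norm rho0) -normrM mulrDl mul1r divfK ?gt_eqF//.
  by rewrite ger0_norm.
have -> : (U (x + t *: (rho^-1 *: x)) - U x) / t = h (rho + t).
  by rewrite /U /radial_ext E xr hE; field; rewrite lt_eqF.
by rewrite -hx; apply: H; rewrite /ball_/= opprD addNKr normrN.
Qed.

End radial_field.

(** The shooting solution solves the problem for [extend0 f]; positivity, which rests on [f 0 = 0],
    turns it into a solution for [f]. *)
Lemma radial_neumann_solution_of_shooting (R : realType) (n : nat) (f g : R -> R) (L d rho : R)
    (u v w : R -> R) : 0 < L -> (forall y z, `|g y - g z| <= L * `|y - z|) ->
  f 0 = 0 -> radial_solution n g d u v w -> 0 < rho -> 0 < d -> v rho = 0 ->
  (forall t, 0 <= t <= rho -> g (u t) = extend0 f (u t)) ->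
  radial_neumann_solution n.+1 f rho u.
Proof.
move=> L0 gL f0 S rho0 d0 vrho gf.
have pos : forall t, 0 <= t <= rho -> 0 < u t.
  apply: (solution_positive L0 gL S rho0 vrho d0) => t tr ut.
  by rewrite gf// /extend0 max_r.
have in_range (x : 'rV[R]_n.+1) : eball rho x -> 0 <= enorm x <= rho.
  by move=> /ltW xr; rewrite enorm_ge0.
split.
- exact: solution_classical_profile L0 gL S rho.
- move=> x /in_range xr; split.
  + exact: differentiable_radial L0 gL S x.
  + exact: differentiable_flux L0 gL S x.
  + rewrite (divergence_flux L0 gL S) opprK gf// /extend0 max_l//.
    by rewrite ltW// pos.
- by move=> x /in_range xr; exact: pos.
- exact: (@neumann_bc_radial _ _ _ _ _ _ _ S _ rho0 vrho).
Qed.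

(* u true j and u false j stand for u_j^+ and u_j^-. *)
Theorem theorem1p1 (R : realType) (N : nat) (f : R -> R)
  (hN : (1 <= N)%N)
  (hfC1 : C1_on `[0, +oo[ f)
  (hf0 : f 0 = 0) (hf1 : f 1 = 0)
  (hfneg : forall s : R, 0 < s < 1 -> f s < 0)
  (hfpos : forall s : R, 1 < s -> 0 < f s)
  (hf'1 : derive1 f 1 = 0) :
  forall k : nat, (1 <= k)%N ->
  exists2 Rk : R, 0 < Rk &
  forall rho : R, Rk <= rho ->
  exists u : bool -> nat -> R -> R,
    [/\ forall (s : bool) (j : nat), (1 <= j <= 2 * k)%N ->
          radial_neumann_solution N f rho (u s j) /\
          non_constant_on `[0, rho] (u s j),
        forall (s t : bool) (i j : nat),
          (1 <= i <= 2 * k)%N -> (1 <= j <= 2 * k)%N -> (s, i) <> (t, j) ->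
          distinct_on `[0, rho] (u s i) (u t j),
        forall j : nat, (1 <= j <= 2 * k)%N -> 1 < u true j 0,
        forall j : nat, (1 <= j <= 2 * k)%N -> u false j 0 < 1 &
        forall (s : bool) (j : nat), (1 <= j <= k)%N ->
          [set r : R | 0 < r < rho /\ u s j r - 1 = 0] #= `I_j /\
          [set r : R | 0 < r < rho /\ u s (2 * k + 1 - j)%N r - 1 = 0] #= `I_j].
Proof.
(* The dimension is [n.+1], so that [n] is the exponent of the weight. *)
move=> k k1; case: N hN => // n _.
have [Rk Rk0 H] := shooting n hfC1 hf0 hf1 hfneg hfpos hf'1 k.
exists Rk => // rho Rrho; have rho0 : 0 < rho by exact: lt_le_trans Rrho.
have [g [L [d [u [v [w [L0 gL g0 Hu Hd]]]]]]] := H rho Rrho.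
have zero_in : `[0, rho]%classic 0 by rewrite /= in_itv/= lexx ltW.
exists u; split.
- move=> s j jk; have [S gf vr [d0 ds] zeros] := Hu s j jk; split.
    exact: (radial_neumann_solution_of_shooting L0 gL hf0 S rho0 d0 vr gf).
  (* At least one zero of [u - 1] exists, and there [u] differs from its value at 0: the solution is
     not constant. *)
  have m0 : (0 < fold_index k j)%N by case/andP: (fold_index_bounds jk).
  have [Z0|/set0P[r [/andP[r0 rr] /eqP]]] := eqVneq [set r | 0 < r < rho /\ u s j r - 1 = 0] set0.
    move: zeros; rewrite Z0 card_eq_sym card_eq0 => /eqP I0.
    by have : `I_(fold_index k j) 0%N by []; rewrite I0.
  rewrite subr_eq0 => /eqP ur; exists 0, r; split => //.
    by rewrite /= in_itv/= !ltW.
  by rewrite (step_u0 S) ur => d1; move: ds; rewrite d1; case: s {jk S gf vr d0 zeros ur d1} => /=; rewrite ltxx.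
- move=> s t i j ik jk neq; exists 0 => //.
  have [S _ _ _ _] := Hu s i ik; have [S' _ _ _ _] := Hu t j jk.
  by rewrite (step_u0 S) (step_u0 S'); exact: Hd.
- by move=> j jk; have [S _ _ [_ ds] _] := Hu true j jk; rewrite (step_u0 S).
- by move=> j jk; have [S _ _ [_ ds] _] := Hu false j jk; rewrite (step_u0 S).
- move=> s j jk; have /andP[j1 jk'] := jk; split.
    have jk2 : (1 <= j <= 2 * k)%N by rewrite j1 mul2n -addnn (leq_trans jk')// leq_addr.
    have [_ _ _ _] := Hu s j jk2; by rewrite /fold_index jk'.
  have [jk2 E] := fold_index_reflect jk.
  by have [_ _ _ _] := Hu s _ jk2; rewrite E.
Qed.
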